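(* Let $\ell\in\mathbb{N}$ (a positive integer) and let $\mathcal{K}^{\ell}(d)$ be the constant defined recursively in the context. Let $d>2\ell$. Then $$ \int_{Q_d}|\Delta^{\ell/2}\psi(x)|^2\,dx\;\ge\;\mathcal{K}^{\ell}(d)\int_{Q_d}\frac{|\psi(x)|^2}{\omega(x)^{2\ell}}\,dx $$ for all functions $\psi\in C^\infty_{\mathrm{per}}(\overline{Q_d})$ having zero average, $\int_{Q_d}\psi\,dx=0$.
   Context: $Q_d:=(-\pi,\pi)^d\subset\mathbb{R}^d$. $C^\infty_{\mathrm{per}}(\overline{Q_d})$ is the space of complex-valued $\psi\in C^\infty(\overline{Q_d})$ such that $\psi$ and all its derivatives are $2\pi$-periodic in each variable, i.e. for each $i$ they take equal values at any two points of $\overline{Q_d}$ that differ only in that the $i$-th coordinate is $-\pi$ for one and $\pi$ for the other (equivalently, smooth functions on the flat torus $[-\pi,\pi]^d$ with opposite faces identified). The weight $\omega\ge 0$ is defined by $\omega(x)^2:=\sum_{j=1}^d\sin^2(x_j/2)$. Here $\nabla=(\partial_{x_1},\dots,\partial_{x_d})$ and $\Delta=\sum_{i=1}^d\partial_{x_i}^2$ are the usual gradient and Laplacian, and $\Delta^{\ell/2}\psi:=\Delta^k\psi$ if $\ell=2k$, $\Delta^{\ell/2}\psi:=\nabla(\Delta^k\psi)$ if $\ell=2k+1$ (with $|\cdot|$ the Euclidean norm on $\mathbb{C}^d$ in the odd case). For a non-negative integer $k$ and a negative real $\beta$ put $$h_k(\beta):=-\beta^2-\frac{\beta(d-2k-2)}{2},\qquad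 r_k(\beta):=h_k(\beta)+\frac{k(d-2k-3)}{2}.$$ For $\ell\ge2$ let $$\mathcal{A}^{\ell}_d:=\{(\alpha,\beta):\ \alpha<0,\ \beta<0,\ r_{\ell-2}(\alpha)>0,\ h_{\ell-1}(\beta)>0\}.$$ The constants $\mathcal{K}^{\ell}(d)$ are defined for $d>2\ell$ by recursion on $\ell$ (for such $d$ the set $\mathcal{A}^\ell_d$ is non-empty and the constants are positive and finite): $$\mathcal{K}^0(d)=1,\qquad \mathcal{K}^1(d)=\frac d2\Big(1-\frac{\sqrt2}{\sqrt d}\Big)^2,$$ $$\text{for even }\ell\ge2:\quad \mathcal{K}^{\ell}(d)=\sup_{(\alpha,\beta)\in\mathcal{A}^{\ell}_d}\frac{r_{\ell-2}(\alpha)\,h_{\ell-1}(\beta)}{\dfrac{-\alpha+\ell-1}{\mathcal{K}^{\ell-2}(d)}-\beta\,\dfrac{r_{\ell-2}(\alpha)}{\mathcal{K}^{\ell-1}(d)}},$$ $$\text{for odd }\ell\ge2:\quad \mathcal{K}^{\ell}(d)=\mathcal{K}^{\ell-1}(d)\sup_{(\alpha,\beta)\in\mathcal{A}^{\ell}_d}\frac{h_{\ell-1}(\beta)}{1-\beta}.$$ *)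

(* Defs.v *)
From HB Require Import structures.
From mathcomp Require Import all_boot all_order all_algebra.
From mathcomp Require Import all_classical all_reals all_analysis.
From mathcomp Require Import complex.

Set Implicit Arguments.
Unset Strict Implicit.
Unset Printing Implicit Defensive.

Import Order.TTheory GRing.Theory Num.Theory.
Import numFieldNormedType.Exports.

Local Open Scope classical_set_scope.
Local Open Scope ring_scope.

(* Lebesgue measure on R^n, built on [n.-tuple R] because that type carries
   the product sigma-algebra: the image of the product of the one-dimensional
   Lebesgue measure with Lebesgue measure on R^(n-1) under (x, t) |-> x :: t. *)
Section cons_measure.
Context (R : realType) (n : nat).
Variable m : {sigma_finite_measure set (n.-tuple R) -> \bar R}.

Definition tuple_of_pair (p : R * n.-tuple R) : n.+1.-tuple R :=
  cons_tuple p.1 p.2.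

Lemma measurable_tuple_of_pair : measurable_fun setT tuple_of_pair.
Proof. exact: (measurable_cons measurable_fst measurable_snd). Qed.

Definition cons_measure : set (n.+1.-tuple R) -> \bar R :=
  pushforward (@lebesgue_measure R \x m)%E tuple_of_pair.

Let cons_measure0 : cons_measure set0 = 0%E.
Proof. by rewrite /cons_measure /pushforward preimage_set0 measure0. Qed.

Let cons_measure_ge0 A : (0 <= cons_measure A)%E.
Proof. exact: (measure_ge0 (@lebesgue_measure R \x m)%E). Qed.

Let cons_measure_sigma_additive : semi_sigma_additive cons_measure.
Proof.
move=> F mF tF mUF; rewrite /cons_measure /pushforward preimage_bigcup.
have mpre A : measurable A -> measurable (tuple_of_pair @^-1` A).
  by move=> mA; rewrite -[X in measurable X]setTI;
     exact: measurable_tuple_of_pair.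
apply: measure_semi_sigma_additive.
- by move=> k; exact: mpre.
- apply/trivIsetP => /= i j _ _ ij; rewrite -preimage_setI.
  by move/trivIsetP : tF => /(_ _ _ _ _ ij) ->//; rewrite preimage_set0.
- by rewrite -preimage_bigcup; exact: mpre.
Qed.

HB.instance Definition _ := isMeasure.Build _ _ _ cons_measure
  cons_measure0 cons_measure_ge0 cons_measure_sigma_additive.

Lemma cons_measureE (A : set R) (B : set (n.-tuple R)) :
  measurable A -> measurable B ->
  cons_measure [set t | A (thead t) /\ B [tuple of behead t]] =
  (@lebesgue_measure R A * m B)%E.
Proof.
move=> mA mB; rewrite -(product_measure1E (@lebesgue_measure R) m mA mB) /cons_measure /pushforward.
congr (product_measure1 _ _ _); apply/seteqP.
split=> -[x t] /=; rewrite theadE;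
  by have -> : [tuple of behead (cons_tuple x t)] = t by exact: val_inj.
Qed.

Let cons_measure_sigma_finite : sigma_finite setT cons_measure.
Proof.
have /sigma_finiteP[F [TF ndF Foo]] := sigma_finiteT (@lebesgue_measure R).
have /sigma_finiteP[G [TG ndG Goo]] := sigma_finiteT m.
exists (fun k => [set t | F k (thead t) /\ G k [tuple of behead t]]).
  apply/seteqP; split=> // t _.
  have : [set: R] (thead t) by []. rewrite TF => -[i _ Fi].
  have : setT [tuple of behead t] by []. rewrite TG => -[j _ Gj].
  exists (maxn i j) => //; split.
    by move: Fi; exact/subsetPset/ndF/leq_maxl.
  by move: Gj; exact/subsetPset/ndG/leq_maxr.
move=> k; have [mF oF] := Foo k; have [mG oG] := Goo k; split.
  apply: measurableI.
    rewrite -[X in measurable X]setTI.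
    exact: (@measurable_tnth _ _ n.+1 ord0).
  rewrite -[X in measurable X]setTI; exact: measurable_behead.
by rewrite cons_measureE// lte_mul_pinfty// ge0_fin_numE.
Qed.

HB.instance Definition _ := Measure_isSigmaFinite.Build _ _ _ cons_measure
  cons_measure_sigma_finite.
End cons_measure.

Fixpoint lebesgue_tuple (R : realType) (n : nat) :
    {sigma_finite_measure set (n.-tuple R) -> \bar R} :=
  match n with
  | 0 => \d_([tuple] : 0.-tuple R)
  | n'.+1 => cons_measure (lebesgue_tuple R n')
  end.


Lemma lebesgue_tuple_box (R : realType) (n : nat) (A : 'I_n -> set R) :
  (forall i, measurable (A i)) ->
  lebesgue_tuple R n [set t | forall i, A i (tnth t i)] =
  (\prod_(i < n) @lebesgue_measure R (A i))%E.
Proof.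
elim: n A => [|n IHn] A mA.
  by rewrite big_ord0 /= diracE mem_set// => -[].
rewrite big_ord_recl -IHn//.
rewrite -cons_measureE//; last first.
  rewrite (_ : [set _ | _] =
      \bigcap_(i in [set: 'I_n]) ((tnth (T:=R))^~ i @^-1` A (lift ord0 i))).
    apply: fin_bigcap_measurable => //.
    move=> i _; rewrite -[X in measurable X]setTI.
    exact: (@measurable_tnth _ _ n i).
  by apply/seteqP; split=> t /= h i; [move=> _; exact: h | exact: h].
congr (cons_measure _ _); apply/seteqP; split=> t /=.
  move=> h; split=> [|i]; first exact: h.
  rewrite -[X in A _ X]/(tnth [tuple of behead t] i).
  by have := h (lift ord0 i); rewrite [in tnth t](tuple_eta t) tnthS.
move=> [h0 h] i; rewrite (tuple_eta t).
by case: (unliftP ord0 i) => [j ->|->]; rewrite ?tnth0// tnthS; exact: h.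
Qed.

Section cube.
Variables (R : realType) (d : nat).

Definition cube : set 'rV[R]_d := [set x | forall i, - pi < x 0 i < pi].

Definition closed_cube : set 'rV[R]_d :=
  [set x | forall i, - pi <= x 0 i <= pi].

Definition rV_of_tuple (t : d.-tuple R) : 'rV[R]_d := \row_i tnth t i.

Definition cube_integral (f : 'rV[R]_d -> \bar R) : \bar R :=
  (\int[lebesgue_tuple R d]_(t in rV_of_tuple @^-1` cube) f (rV_of_tuple t))%E.

Definition cube_Rintegral (f : 'rV[R]_d -> R) : R :=
  \int[lebesgue_tuple R d]_(t in rV_of_tuple @^-1` cube) f (rV_of_tuple t).

Definition cube_Cintegral (f : 'rV[R]_d -> R[i]) : R[i] :=
  (cube_Rintegral (@complex.Re R \o f) +i* cube_Rintegral (@complex.Im R \o f))%C.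

Definition partial (i : 'I_d) (f : 'rV[R]_d -> R[i]) (x : 'rV[R]_d) : R[i] :=
  ('D_(delta_mx 0 i) (@complex.Re R \o f) x +i*
   'D_(delta_mx 0 i) (@complex.Im R \o f) x)%C.

Definition partially_derivable (i : 'I_d) (f : 'rV[R]_d -> R[i])
    (x : 'rV[R]_d) : Prop :=
  derivable (@complex.Re R \o f) x (delta_mx 0 i) /\
  derivable (@complex.Im R \o f) x (delta_mx 0 i).

Definition grad (f : 'rV[R]_d -> R[i]) (x : 'rV[R]_d) : 'rV[R[i]]_d :=
  \row_i partial i f x.

Definition laplacian (f : 'rV[R]_d -> R[i]) (x : 'rV[R]_d) : R[i] :=
  \sum_(i < d) partial i (partial i f) x.

Definition euclidean_norm (v : 'rV[R[i]]_d) : R :=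
  Num.sqrt (\sum_(i < d) Normc.normc (v 0 i) ^+ 2).

Definition norm_half_laplacian (l : nat) (f : 'rV[R]_d -> R[i])
    (x : 'rV[R]_d) : R :=
  if odd l then euclidean_norm (grad (iter l./2 laplacian f) x)
  else Normc.normc (iter l./2 laplacian f x).

(* [g s] is the continuous extension to the closed cube of the iterated
   partial derivative of [f] along the indices listed in [s]; derivatives are
   only taken in the open cube, and [f] is unconstrained off the closed cube. *)
Definition closure_derivatives (f : 'rV[R]_d -> R[i])
    (g : seq 'I_d -> 'rV[R]_d -> R[i]) : Prop :=
  [/\ forall x, closed_cube x -> g [::] x = f x,
      forall s, {within closed_cube, continuous (@complex.Re R \o g s)} /\
                {within closed_cube, continuous (@complex.Im R \o g s)}
    & forall s i x, cube x ->
        partially_derivable i (g s) x /\ g (i :: s) x = partial i (g s) x].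

Definition face_periodic (f : 'rV[R]_d -> R[i]) : Prop :=
  forall (i : 'I_d) (x y : 'rV[R]_d), closed_cube x -> closed_cube y ->
    x 0 i = - pi -> y 0 i = pi -> (forall j, j != i -> x 0 j = y 0 j) ->
    f x = f y.

Definition Cinfty_per (f : 'rV[R]_d -> R[i]) : Prop :=
  exists2 g, closure_derivatives f g & forall s, face_periodic (g s).

Definition omega (x : 'rV[R]_d) : R :=
  Num.sqrt (\sum_(j < d) sin (x 0 j / 2) ^+ 2).

End cube.

Section constants.
Variables (R : realType) (d : nat).

Definition h_ (k : nat) (b : R) : R :=
  - b ^+ 2 - b * (d%:R - 2 * k%:R - 2) / 2.

Definition r_ (k : nat) (b : R) : R :=
  h_ k b + k%:R * (d%:R - 2 * k%:R - 3) / 2.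

(* Meant for [2 <= l], so that the subtractions are exact. *)
Definition admissible (l : nat) : set (R * R) :=
  [set ab | [/\ ab.1 < 0, ab.2 < 0,
                0 < r_ (l - 2)%N ab.1 & 0 < h_ (l - 1)%N ab.2]].

(* In the recursive case [l = m.+2], with [m.+1] and [m] standing for [l - 1]
   and [l - 2]. For [2 * l < d] the sets under [sup] are nonempty and bounded;
   otherwise the value is meaningless. *)
Fixpoint K_ (l : nat) : R :=
  match l with
  | 0 => 1
  | l'.+1 =>
    match l' with
    | 0 => d%:R / 2 * (1 - Num.sqrt 2 / Num.sqrt d%:R) ^+ 2
    | m.+1 =>
      if odd l then
        K_ l' * sup [set h_ (l - 1)%N ab.2 / (1 - ab.2) | ab in admissible l]
      else
        sup [set r_ (l - 2)%N ab.1 * h_ (l - 1)%N ab.2 /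
                 ((- ab.1 + (l - 1)%:R) / K_ m
                  - ab.2 * (r_ (l - 2)%N ab.1 / K_ l'))
            | ab in admissible l]
    end
  end.

End constants.

(* Main.v *)
Require Import Defs.
From HB Require Import structures.
From mathcomp Require Import all_boot all_order all_algebra.
From mathcomp Require Import all_classical all_reals all_analysis.
From mathcomp Require Import measurable_realfun complex.
From mathcomp Require Import ring lra.

Set Implicit Arguments.
Unset Strict Implicit.
Unset Printing Implicit Defensive.

Import Order.TTheory GRing.Theory Num.Theory.
Import numFieldNormedType.Exports.

Local Open Scope classical_set_scope.
Local Open Scope ring_scope.

(** Put [W = omega^2], so that [d_i W = sin x_i / 2].  Everything rests on three
    facts: [|grad W|^2 <= W], [Lap W = d/2 - W], and [d_i d_j W = 0] for [i != j]
    while [d_i d_i W <= 1/2].  They survive when [W] is replaced by [W + eps] with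
    [eps > 0], the second one as a lower bound with the same constants.  All the
    inequalities below are therefore proved for the smooth weight
    [q = 1 / (W + eps)], where integration by parts raises no question at the
    origin, and [eps] tends to 0 only at the very end, by monotone convergence
    ([cube_integral_weight_le]).  Real and imaginary parts are treated separately.

    Three inequalities carry the proof, for real periodic functions:
    - the Poincare inequality [int u^2 <= int |grad u|^2] for functions of mean
      zero ([Int_poincare]): the one-dimensional inequality with constant 1
      ([wirtinger]) passes to products because the variance of an average is at
      most the average of the variances ([variance_of_mean]);
    - the weighted Hardy inequality ([weighted_hardy])
      [h_k(b) int q^(k+1) u^2 + b int q^k u^2 <= int q^k |grad u|^2] for [b < 0],
      obtained from a square and one integration by parts;
    - the weighted Rellich inequality ([weighted_rellich])
      [r_k(a) int q^(k+1) |grad u|^2 <= int q^k (Lap u)^2 + (k - a) int q^k |grad u|^2]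
      for [a < 0]: a weighted Bochner identity replaces [(Lap u)^2] by the squared
      Hessian, to which the Hardy inequality of each partial derivative applies.

    The theorem follows by induction on [l].  Since all partial derivatives of a
    periodic function have mean zero and commute with the Laplacian, the inequality
    of order [k] may be applied to the partial derivatives of [u] and to [Lap u],
    and bounds every integral weighted by [q^k].  For odd [l = k + 1] one combines
    the Hardy inequality of weight [k] with the case [k] ([odd_step]).  For even
    [l = k + 2] one combines the Hardy inequality of weight [k + 1], the Rellich
    inequality of weight [k], and the cases [k] and [k + 1] ([even_step]).  Both
    give the inequality with the quotient appearing under the supremum that defines
    the constant, for each admissible pair of parameters; for [l = 1] the best
    parameter is explicit ([K_one]). *)

(** * Calculus in one variable, and the sharp Wirtinger inequality *)

Section calculus.
Context {R : realType} {V : normedModType R}.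
Implicit Types (f g : V -> R) (x v : V).

Lemma der_eq f x v (a b : R) : is_derive x v f a -> a = b -> is_derive x v f b.
Proof. by move=> + <-. Qed.

Lemma derC (c : R) x v : is_derive x v (fun _ : V => c) 0.
Proof. exact: (is_derive_cst c). Qed.

Lemma derD f g x v (a b : R) : is_derive x v f a -> is_derive x v g b ->
  is_derive x v (fun y => f y + g y) (a + b).
Proof. by move=> ? ?; exact: (@is_deriveD _ _ _ f g). Qed.

Lemma derM f g x v (a b : R) : is_derive x v f a -> is_derive x v g b ->
  is_derive x v (fun y => f y * g y) (a * g x + f x * b).
Proof.
move=> df dg; apply: (der_eq (@is_deriveM _ _ f g _ _ _ _ df dg)).
rewrite /GRing.scale /=; ring.
Qed.

Lemma derZ f x v (k a : R) : is_derive x v f a ->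
  is_derive x v (fun y => k * f y) (k * a).
Proof. by move=> df; apply: (der_eq (derM (derC k x v) df)); ring. Qed.

Lemma derN f x v (a : R) : is_derive x v f a -> is_derive x v (fun y => - f y) (- a).
Proof. by move=> ?; exact: (@is_deriveN _ _ _ f). Qed.

Lemma derX f x v (a : R) n : is_derive x v f a ->
  is_derive x v (fun y => f y ^+ n) (n%:R * f x ^+ n.-1 * a).
Proof.
move=> df; elim: n => [|n IH].
  by rewrite !mul0r; under eq_fun do rewrite expr0; exact: derC.
under eq_fun do rewrite exprS.
apply: (der_eq (derM df IH)); case: n {IH} => [|n] /=; first by ring.
by rewrite -[in RHS]natr1 !exprS; ring.
Qed.

Lemma derV f x v (a : R) : f x != 0 -> is_derive x v f a ->
  is_derive x v (fun y => (f y)^-1) (- (f x)^-1 ^+ 2 * a).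
Proof.
move=> f0 [df <-]; apply: DeriveDef; first exact: derivableV.
by rewrite deriveV// /GRing.scale /= exprVn.
Qed.

Lemma der_sum (I : Type) (r : seq I) (h : I -> V -> R) (a : I -> R) x v :
  (forall i, is_derive x v (h i) (a i)) ->
  is_derive x v (fun y => \sum_(i <- r) h i y) (\sum_(i <- r) a i).
Proof.
move=> dh; elim: r => [|i r IH].
  by rewrite big_nil; under eq_fun do rewrite big_nil; exact: derC.
by rewrite big_cons; under eq_fun do rewrite big_cons; exact: derD.
Qed.

Lemma der_id (y : R) : is_derive y 1 (fun z : R => z) (1 : R).
Proof. exact: is_derive_id. Qed.
End calculus.

Section one_dim.
Context {R : realType}.
Notation mu := (@lebesgue_measure R).
Implicit Types (u v : R -> R).

Lemma within_contD (T : topologicalType) (A : set T) (f g : T -> R) :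
  {within A, continuous f} -> {within A, continuous g} ->
  {within A, continuous (fun x => f x + g x)}.
Proof. by move=> cf cg x; exact: continuousD (cf x) (cg x). Qed.

Lemma within_contM (T : topologicalType) (A : set T) (f g : T -> R) :
  {within A, continuous f} -> {within A, continuous g} ->
  {within A, continuous (fun x => f x * g x)}.
Proof. by move=> cf cg x; exact: continuousM (cf x) (cg x). Qed.

Lemma within_cont_cst (T : topologicalType) (A : set T) (c : R) :
  {within A, continuous (fun _ : T => c)}.
Proof. by move=> x; exact: cvg_cst. Qed.

Lemma within_contN (T : topologicalType) (A : set T) (f : T -> R) :
  {within A, continuous f} -> {within A, continuous (fun x => - f x)}.
Proof. by move=> cf x; exact: continuousN (cf x). Qed.

Lemma within_contX (T : topologicalType) (A : set T) (f : T -> R) n :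
  {within A, continuous f} -> {within A, continuous (fun x => f x ^+ n)}.
Proof.
move=> cf; elim: n => [|n IH].
  by under eq_fun do rewrite expr0; exact: within_cont_cst.
by under eq_fun do rewrite exprS; exact: within_contM.
Qed.

Lemma within_cont_integrable a b v : {within `[a, b], continuous v} ->
  mu.-integrable `[a, b] (EFin \o v).
Proof. by move=> cv; apply: continuous_compact_integrable => //; exact: segment_compact. Qed.

(** [is_derive] is a class: left in the open, this hypothesis would be submitted to
    instance resolution. *)
Definition deriv_on (a b : R) u v := forall x : R, x \in `]a, b[ -> is_derive x 1 u (v x).

Lemma FTC_within a b u v : a <= b ->
  {within `[a, b], continuous u} -> {within `[a, b], continuous v} ->
  deriv_on a b u v ->
  \int[mu]_(x in `[a, b]) v x = u b - u a.
Proof.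
rewrite le_eqVlt => /predU1P[<- _ _ _|ab cu cv uv].
  by rewrite set_itv1 Rintegral_set1 subrr.
rewrite /Rintegral (@continuous_FTC2 _ v u) //.
- have [_ ua ub] := (continuous_within_itvP _ ab).1 cu.
  by split => // x xab; case: (uv _ xab).
- by move=> x xab; rewrite derive1E; case: (uv _ xab).
Qed.

(** Solution of the Riccati equation [p' = - la^2 - p^2] associated with
    [f'' = - la^2 f]. *)
Definition riccati (la m x : R) := - la * tan (la * (x - m)).

Lemma is_derive_riccati (la m x : R) : cos (la * (x - m)) != 0 ->
  is_derive x 1 (riccati la m) (- la ^+ 2 - riccati la m x ^+ 2).
Proof.
move=> c0.
have dg : is_derive x 1 (fun x => la * (x - m)) la.
  by apply: (der_eq (derZ la (derD (der_id x) (derC (- m) x 1)))); ring.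
have dc := @is_derive1_comp _ tan (fun x : R => la * (x - m)) _ _ _ (is_derive_tan c0) dg.
apply: (der_eq (derZ (- la) dc)).
rewrite /riccati -[(cos _)^-2]/((cos _)^-2) cos2_tan2//; ring.
Qed.

(** Integrate [(v - p u)^2 >= 0], where [p] is the Riccati solution centred at [m]; it
    has no pole on [[a, b]].  Only boundary terms remain. *)
Lemma wirtinger_piece (la m a b : R) u v : a <= b ->
  (forall x, a <= x <= b -> - (pi / 2) < la * (x - m) < pi / 2) ->
  {within `[a, b], continuous u} -> {within `[a, b], continuous v} ->
  deriv_on a b u v ->
  riccati la m b * u b ^+ 2 - riccati la m a * u a ^+ 2 <=
  \int[mu]_(x in `[a, b]) (v x ^+ 2 - la ^+ 2 * u x ^+ 2).
Proof.
move=> ab lam cu cv uv.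
have c0 x : a <= x <= b -> cos (la * (x - m)) != 0.
  by move=> /lam /cos_gt0_pihalf /lt0r_neq0.
have cw : {within `[a, b], continuous (riccati la m)}.
  apply: derivable_within_continuous => x; rewrite in_itv/= => xab.
  by case: (is_derive_riccati (c0 _ xab)).
set F := fun x => riccati la m x * u x ^+ 2.
set f := fun x => (- la ^+ 2 - riccati la m x ^+ 2) * u x ^+ 2 + riccati la m x * (2 * u x * v x).
have cF : {within `[a, b], continuous F}.
  by apply: within_contM => //; exact: within_contX.
have cf : {within `[a, b], continuous f}.
  apply: within_contD; apply: within_contM.
  - apply: within_contD; first exact: within_cont_cst.
    by apply: within_contN; exact: within_contX.
  - exact: within_contX.
  - exact: cw.
  - by apply: within_contM => //; apply: within_contM => //; exact: within_cont_cst.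
have <- : \int[mu]_(x in `[a, b]) f x = F b - F a.
  apply: (FTC_within ab cF cf) => x xab.
  have xab' : a <= x <= b by move: xab; rewrite in_itv/= => /andP[/ltW-> /ltW->].
  have dw := is_derive_riccati (c0 _ xab'); have du := uv _ xab.
  by apply: (der_eq (derM dw (derX 2 du))); rewrite /f /= expr1; ring.
apply: le_Rintegral => //.
- exact: within_cont_integrable.
- apply: within_cont_integrable; apply: within_contD; first exact: within_contX.
  by apply: within_contN; apply: within_contM; [exact: within_cont_cst|exact: within_contX].
- move=> x _; rewrite /f -subr_ge0.
  rewrite [X in 0 <= X](_ : _ = (v x - riccati la m x * u x) ^+ 2) ?sqr_ge0//; ring.
Qed.
End one_dim.

Lemma within_contP (R : realType) (T : pseudoMetricType R) (A : set T) (f : T -> R) :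
  {within A, continuous f} <->
  (forall x, A x -> forall e, 0 < e ->
    exists2 d, 0 < d & forall y, A y -> ball x d y -> `|f x - f y| < e).
Proof.
split=> [/subspace_continuousP cf x Ax e e0|cf].
  have /cvgrPdist_lt/(_ _ e0) := cf x Ax.
  rewrite near_withinE => /nbhs_ballP[d /= d0 dh]; exists d => // y Ay xy.
  exact: dh.
apply/subspace_continuousP => x Ax; apply/cvgrPdist_lt => e e0.
have [d d0 dh] := cf x Ax e e0.
rewrite near_withinE; apply/nbhs_ballP; exists d => //= y xy Ay.
exact: dh.
Qed.

Section wirtinger.
Context {R : realType}.
Notation mu := (@lebesgue_measure R).
Implicit Types (u v : R -> R).

Lemma Rintegral_itv_split (a c b : R) u : a <= c <= b ->
  {within `[a, b], continuous u} ->
  \int[mu]_(x in `[a, b]) u x = \int[mu]_(x in `[a, c]) u x + \int[mu]_(x in `[c, b]) u x.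
Proof.
move=> /andP[ac cb] cu; have iu := within_cont_integrable cu.
apply/eqP; rewrite addrC -subr_eq; apply/eqP.
rewrite Rintegral_itvB// ?bnd_simp//.
apply: Rintegral_itv_obnd_cbnd; apply: integrableS iu => //.
by apply: subset_itvr; rewrite bnd_simp.
Qed.

Definition periodic_deriv1 u v := [/\ {within `[- pi, pi], continuous u},
  {within `[- pi, pi], continuous v},
  deriv_on (- pi) pi u v & u (- pi) = u pi].

(** The function [u x - u (x + pi)] takes opposite values at [- pi] and [0]. *)
Lemma antipodal_eq u : {within `[- pi, pi], continuous u} -> u (- pi) = u pi ->
  exists2 a, - pi <= a <= 0 & u a = u (a + pi).
Proof.
move=> cu up; have p0 := pi_ge0 R.
pose f x := u x - u (x + pi).
have [] := @IVT R f (- pi) 0 0.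
- by rewrite oppr_le0.
- apply: within_contD.
    by apply: continuous_subspaceW cu; apply: subset_itvl; rewrite bnd_simp.
  apply: within_contN; apply/within_contP => x; rewrite /= in_itv/= => /andP[x1 x2] e e0.
  have xp : [set` `[- pi, pi]] (x + pi) by rewrite /= in_itv/=; lra.
  have [d d0 dh] := (within_contP _ _).1 cu _ xp e e0.
  exists d => // y; rewrite /= in_itv/= => /andP[y1 y2] xy; apply: dh.
    by rewrite /= in_itv/=; lra.
  by rewrite /ball /= (_ : x + pi - (y + pi) = x - y)//; ring.
- have -> : f 0 = - f (- pi) by rewrite /f addNr add0r up; ring.
  by rewrite ge_min le_max; lra.
- move=> a; rewrite in_itv/= => a1 /eqP; rewrite subr_eq0 => /eqP a2.
  by exists a.
Qed.

(** With [c] the common value of [u] at two antipodal points, [u - c] vanishes at both.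
    They cut the circle into arcs of length [pi], on which the Riccati solution centred
    at the midpoint is regular since [la < 1].  The arc through [pi] is seen as two
    intervals, whose boundary terms at [- pi] and [pi] cancel. *)
Lemma wirtinger_scaled u v : periodic_deriv1 u v -> exists c : R, forall la : R, 0 < la < 1 ->
  la ^+ 2 * \int[mu]_(x in `[- pi, pi]) ((u x - c) ^+ 2) <=
  \int[mu]_(x in `[- pi, pi]) (v x ^+ 2).
Proof.
move=> [cu cv uv up]; have p0 := pi_gt0 R.
have [a /andP[a1 a2] ua] := antipodal_eq cu up.
exists (u a) => la /andP[la0 la1].
pose w x := u x - u a.
have cw : {within `[- pi, pi], continuous w}.
  by apply: within_contD => //; exact: within_cont_cst.
have wv : deriv_on (- pi) pi w v.
  by move=> x xp; apply: (der_eq (derD (uv x xp) (derC (- u a) x 1))); rewrite addr0.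
have cg : {within `[- pi, pi], continuous (fun x => v x ^+ 2 - la ^+ 2 * w x ^+ 2)}.
  apply: within_contD; first exact: within_contX.
  by apply: within_contN; apply: within_contM; [exact: within_cont_cst|exact: within_contX].
rewrite -RintegralZl//; last by apply: within_cont_integrable; exact: within_contX.
rewrite -subr_ge0 -RintegralB//; last 2 first.
- by apply: within_cont_integrable; exact: within_contX.
- by apply: within_cont_integrable; apply: within_contM; [exact: within_cont_cst|exact: within_contX].
have sub (x y : R) : - pi <= x -> y <= pi -> `[x, y] `<=` `[- pi, pi].
  by move=> x1 y1; apply: subset_itv; rewrite bnd_simp.
have subo (x y z : R) : - pi <= x -> y <= pi -> z \in `]x, y[ -> z \in `]- pi, pi[.
  move=> x1 y1; rewrite !in_itv/=; lra.
have key (x y m : R) : - pi <= x -> x <= y -> y <= pi -> m - pi / 2 <= x -> y <= m + pi / 2 ->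
  riccati la m y * w y ^+ 2 - riccati la m x * w x ^+ 2 <=
  \int[mu]_(t in `[x, y]) (v t ^+ 2 - la ^+ 2 * w t ^+ 2).
  move=> x1 xy y1 mx my; apply: (@wirtinger_piece R la m x y w v xy).
  - move=> t /andP[t1 t2].
    have tm : `|t - m| <= pi / 2 by rewrite ler_norml; lra.
    suff : `|la * (t - m)| < pi / 2 by rewrite ltr_norml.
    rewrite normrM (gtr0_norm la0); apply: le_lt_trans (_ : la * (pi / 2) < _).
      by rewrite ler_pM2l.
    by rewrite gtr_pMl//; lra.
  - by apply: continuous_subspaceW cw; exact: sub.
  - by apply: continuous_subspaceW cv; exact: sub.
  - by move=> z zxy; apply: wv; exact: subo zxy.
rewrite (@Rintegral_itv_split _ a); [|lra|exact: cg].
rewrite (@Rintegral_itv_split a (a + pi) pi); [|lra|]; last first.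
  by apply: continuous_subspaceW cg; exact: sub.
have k1 := key (- pi) a (a - pi / 2) _ _ _ _ _.
have k2 := key a (a + pi) (a + pi / 2) _ _ _ _ _.
have k3 := key (a + pi) pi (a + 3 * pi / 2) _ _ _ _ _.
have wa : w a = 0 by rewrite /w subrr.
have wap : w (a + pi) = 0 by rewrite /w -ua subrr.
have wp : w (- pi) = w pi by rewrite /w up.
have tp : riccati la (a - pi / 2) (- pi) = riccati la (a + 3 * pi / 2) pi.
  by rewrite /riccati; congr (_ * tan (_ * _)); field.
move: k1 k2 k3; rewrite wa wap wp tp expr0n/= !mulr0 => k1 k2 k3.
have {}k1 : 0 - riccati la (a + 3 * pi / 2) pi * w pi ^+ 2 <=
    \int[mu]_(t in `[- pi, a]) (v t ^+ 2 - la ^+ 2 * w t ^+ 2).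
  by apply: k1; clear -a1 a2 p0; lra.
have {}k2 : 0 - 0 <= \int[mu]_(t in `[a, a + pi]) (v t ^+ 2 - la ^+ 2 * w t ^+ 2).
  by apply: k2; clear -a1 a2 p0; lra.
have {}k3 : riccati la (a + 3 * pi / 2) pi * w pi ^+ 2 - 0 <=
    \int[mu]_(t in `[a + pi, pi]) (v t ^+ 2 - la ^+ 2 * w t ^+ 2).
  by apply: k3; clear -a1 a2 p0; lra.
by rewrite -/w; lra.
Qed.

(** Let [la] tend to 1; replacing the constant [c] by the mean value of [u] only
    decreases the integral of [(u - c)^2]. *)
Lemma wirtinger u v : periodic_deriv1 u v ->
  \int[mu]_(x in `[- pi, pi]) (u x ^+ 2) - (\int[mu]_(x in `[- pi, pi]) u x) ^+ 2 / (2 * pi) <=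
  \int[mu]_(x in `[- pi, pi]) (v x ^+ 2).
Proof.
move=> uv; have [c hc] := wirtinger_scaled uv; case: uv => cu cv _ _.
have p0 := pi_gt0 R.
set A := (X in _ <= X); set B := \int[mu]_(x in _) _; set C := \int[mu]_(x in _) _.
have A0 : 0 <= A by apply: Rintegral_ge0 => x _; exact: sqr_ge0.
have E : \int[mu]_(x in `[- pi, pi]) ((u x - c) ^+ 2) = B - 2 * c * C + 2 * pi * c ^+ 2.
  transitivity (\int[mu]_(x in `[- pi, pi]) (u x ^+ 2 + (- (2 * c)) * u x + c ^+ 2)).
    by apply: eq_Rintegral => x _; ring.
  have i0 : mu.-integrable `[- pi, pi] (EFin \o (fun=> c ^+ 2)).
    by apply: within_cont_integrable; exact: within_cont_cst.
  have i1 : mu.-integrable `[- pi, pi] (EFin \o (fun x => - (2 * c) * u x)).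
    by apply: within_cont_integrable; apply: within_contM cu; exact: within_cont_cst.
  have i2 : mu.-integrable `[- pi, pi] (EFin \o (fun x => u x ^+ 2)).
    by apply: within_cont_integrable; exact: within_contX.
  have i12 : mu.-integrable `[- pi, pi] (EFin \o (fun x => u x ^+ 2 + - (2 * c) * u x)).
    apply: within_cont_integrable; apply: within_contD; first exact: within_contX.
    by apply: within_contM cu; exact: within_cont_cst.
  rewrite (RintegralD _ i12 i0)// (RintegralD _ i2 i1)//.
  rewrite RintegralZl//; last exact: within_cont_integrable.
  rewrite Rintegral_cst//= lebesgue_measure_itv/= lte_fin ifT; last lra.
  by rewrite -EFinB/= /B /C; ring.
have {}hc (la : R) : 0 < la < 1 -> la * (B - 2 * c * C + 2 * pi * c ^+ 2) <= A.
  move=> la01; rewrite -E.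
  have sq : 0 < Num.sqrt la < 1.
    by rewrite sqrtr_gt0 -{1}(@sqrtr1 R) ltr_sqrt; lra.
  by have := hc _ sq; rewrite sqr_sqrtr//; clear -la01; lra.
have {hc} : B - 2 * c * C + 2 * pi * c ^+ 2 <= A.
  rewrite leNgt; apply/negP => AY.
  set Y := (X in _ < X) in AY hc.
  have Y0 : 0 < Y by apply: le_lt_trans AY.
  have /hc : 0 < (A / Y + 1) / 2 < 1.
    have z0 : 0 <= A / Y by apply: divr_ge0 => //; exact: ltW.
    have z1 : A / Y < 1 by rewrite ltr_pdivrMr// mul1r.
    clear -z0 z1; lra.
  have -> : (A / Y + 1) / 2 * Y = (A + Y) / 2 by field; rewrite gt_eqF.
  by move: AY; rewrite -/Y => AY YA; clear -AY YA; lra.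
apply: le_trans; rewrite -subr_ge0.
rewrite [X in 0 <= X](_ : _ = (C - 2 * pi * c) ^+ 2 / (2 * pi)); last by field; lra.
by rewrite divr_ge0 ?sqr_ge0//; lra.
Qed.
End wirtinger.

(** * Integrals over products of sets of finite measure *)

Section bounded_measurable.
Context {d : measure_display} {T : measurableType d} {R : realType}.
Variables (m : {measure set T -> \bar R}) (A : set T).
Hypotheses (mA : measurable A) (fA : (m A < +oo)%E).
Implicit Types f g : T -> R.

(** On a set of finite measure this class consists of integrable functions, and it is
    stable under products, slices and partial integration. *)
Definition bounded_measurable f := measurable_fun A f /\ exists M, forall x, A x -> `|f x| <= M.

Lemma bmeas_integrable f : bounded_measurable f -> m.-integrable A (EFin \o f).
Proof.
move=> [mf [M fM]]; apply: measurable_bounded_integrable => //.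
exists M; split; first exact: num_real.
by move=> x Mx y Ay; rewrite /= (le_trans (fM _ Ay))// ltW.
Qed.

Lemma bmeas_cst c : bounded_measurable (fun _ => c).
Proof. by split; [exact: measurable_cst|exists `|c|]. Qed.

Lemma bmeasD f g : bounded_measurable f -> bounded_measurable g ->
  bounded_measurable (fun x => f x + g x).
Proof.
move=> [mf [M fM]] [mg [N gN]]; split; first exact: measurable_funD.
by exists (M + N) => x Ax; rewrite (le_trans (ler_normD _ _))// lerD ?fM ?gN.
Qed.

Lemma bmeasM f g : bounded_measurable f -> bounded_measurable g ->
  bounded_measurable (fun x => f x * g x).
Proof.
move=> [mf [M fM]] [mg [N gN]]; split; first exact: measurable_funM.
by exists (M * N) => x Ax; rewrite normrM ler_pM ?fM ?gN.
Qed.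

Lemma bmeasZ c f : bounded_measurable f -> bounded_measurable (fun x => c * f x).
Proof. by move=> bf; apply: bmeasM => //; exact: bmeas_cst. Qed.

Lemma bmeasX n f : bounded_measurable f -> bounded_measurable (fun x => f x ^+ n).
Proof.
move=> bf; elim: n => [|n IH].
  by under eq_fun do rewrite expr0; exact: bmeas_cst.
by under eq_fun do rewrite exprS; exact: bmeasM.
Qed.

Lemma bmeas_sum (I : Type) (r : seq I) (f : I -> T -> R) :
  (forall i, bounded_measurable (f i)) -> bounded_measurable (fun x => \sum_(i <- r) f i x).
Proof.
move=> bf; elim: r => [|i r IH].
  by under eq_fun do rewrite big_nil; exact: bmeas_cst.
by under eq_fun do rewrite big_cons; exact: bmeasD.
Qed.

Lemma bRintegralD f g : bounded_measurable f -> bounded_measurable g ->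
  \int[m]_(x in A) (f x + g x) = \int[m]_(x in A) f x + \int[m]_(x in A) g x.
Proof. by move=> bf bg; rewrite RintegralD//; exact: bmeas_integrable. Qed.

Lemma bRintegralZ c f : bounded_measurable f ->
  \int[m]_(x in A) (c * f x) = c * \int[m]_(x in A) f x.
Proof. by move=> bf; rewrite RintegralZl//; exact: bmeas_integrable. Qed.

Lemma bRintegral_le f g : bounded_measurable f -> bounded_measurable g -> (forall x, A x ->
  f x <= g x) ->
  \int[m]_(x in A) f x <= \int[m]_(x in A) g x.
Proof. by move=> bf bg fg; apply: le_Rintegral => //; exact: bmeas_integrable. Qed.

Lemma bRintegral_EFin f : bounded_measurable f ->
  (\int[m]_(x in A) f x)%:E = (\int[m]_(x in A) (f x)%:E)%E.
Proof. by move=> bf; rewrite fineK//; apply: integrable_fin_num => //; exact: bmeas_integrable. Qed.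

Lemma bRintegral_norm f M : (forall x, A x -> `|f x| <= M) -> bounded_measurable f ->
  `|\int[m]_(x in A) f x| <= M * fine (m A).
Proof.
move=> fM bf; rewrite -Rintegral_cst//.
apply: le_trans (le_normr_Rintegral mA (bmeas_integrable bf)) _.
apply: bRintegral_le => //; last exact: bmeas_cst.
by case: bf => mf _; split; [exact: measurableT_comp|exists M => x Ax; rewrite normr_id fM].
Qed.

Hypothesis A0 : (0 < m A)%E.
Let a := fine (m A).
Let a0 : 0 < a. Proof. by rewrite /a fine_gt0// A0. Qed.

(** Expanding the square about the mean is what makes the mean the best constant. *)
Lemma Rintegral_variance f : bounded_measurable f ->
  \int[m]_(x in A) ((f x - (\int[m]_(x in A) f x) / a) ^+ 2) =
  \int[m]_(x in A) (f x ^+ 2) - (\int[m]_(x in A) f x) ^+ 2 / a.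
Proof.
move=> bf; set I := \int[m]_(x in A) f x.
transitivity (\int[m]_(x in A) (f x ^+ 2 + (- (2 * (I / a)) * f x + (I / a) ^+ 2))).
  by apply: eq_Rintegral => x _; ring.
rewrite !bRintegralD//; first last.
- by apply: bmeasD; [exact: bmeasZ|exact: bmeas_cst].
- exact: bmeasX.
- exact: bmeas_cst.
- exact: bmeasZ.
by rewrite bRintegralZ// Rintegral_cst//= -/I -/a; field; rewrite gt_eqF.
Qed.

(** The variance is nonnegative. *)
Lemma Rintegral_sqr_le f : bounded_measurable f ->
  (\int[m]_(x in A) f x) ^+ 2 <= a * \int[m]_(x in A) (f x ^+ 2).
Proof.
move=> bf; rewrite mulrC -ler_pdivrMr// -subr_ge0 -Rintegral_variance//.
by apply: Rintegral_ge0 => x _; exact: sqr_ge0.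
Qed.
End bounded_measurable.

Section product.
Context {d1 d2 : measure_display} {X : measurableType d1} {Y : measurableType d2}.
Context {R : realType}.
Variables (m1 : {sigma_finite_measure set X -> \bar R}).
Variables (m2 : {sigma_finite_measure set Y -> \bar R}).
Variables (A : set X) (B : set Y).
Hypotheses (mA : measurable A) (mB : measurable B).
Hypotheses (fA : (m1 A < +oo)%E) (fB : (m2 B < +oo)%E).
Implicit Types (F : X * Y -> R).

Let mAB : measurable (A `*` B). Proof. exact: measurableX. Qed.

Lemma product_set_fin : ((m1 \x m2)%E (A `*` B) < +oo)%E.
Proof. by rewrite product_measure1E// lte_mul_pinfty// ge0_fin_numE. Qed.

Let fAB := product_set_fin.

Lemma bmeas_slicel F x : A x -> bounded_measurable (A `*` B) F ->
  bounded_measurable B (fun y => F (x, y)).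
Proof.
move=> Ax [mF [M FM]]; split; last by exists M => y By; exact: FM.
apply: (@measurable_comp _ _ _ _ _ _ (A `*` B) F _ (fun y => (x, y))) => //.
  by move=> _ [y By <-].
by apply: measurable_funTS; exact: measurable_pair1.
Qed.

Lemma bmeas_slicer F y : B y -> bounded_measurable (A `*` B) F ->
  bounded_measurable A (fun x => F (x, y)).
Proof.
move=> By [mF [M FM]]; split; last by exists M => x Ax; exact: FM.
apply: (@measurable_comp _ _ _ _ _ _ (A `*` B) F _ (fun x => (x, y))) => //.
  by move=> _ [x Ax <-].
by apply: measurable_funTS; exact: measurable_pair2.
Qed.

Lemma bmeas_snd (f : Y -> R) : bounded_measurable B f ->
  bounded_measurable (A `*` B) (fun p => f p.2).
Proof.
move=> [mf [M fM]]; split; last by exists M => -[x y] [_ By]; exact: fM.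
apply: (@measurable_comp _ _ _ _ _ _ B f _ snd) => //; first by move=> _ [[x y] [_ By] <-].
by apply: measurable_funTS; exact: measurable_snd.
Qed.

Section fixed.
Variable F : X * Y -> R.
Hypothesis bF : bounded_measurable (A `*` B) F.
Let f := (EFin \o F) \_ (A `*` B).

Let intf : (m1 \x m2)%E.-integrable setT f.
Proof.
apply/(integrable_mkcond _ mAB).
exact: (bmeas_integrable mAB product_set_fin bF).
Qed.

Let inner x : (\int[m2]_y f (x, y) = ((fun x => (\int[m2]_(y in B) F (x, y))%:E) \_ A) x)%E.
Proof.
rewrite patchE; case: ifPn => [/set_mem Ax|/negP nAx].
  rewrite (bRintegral_EFin mB fB (bmeas_slicel Ax bF)) [RHS]integral_mkcond.
  apply: eq_integral => y _; rewrite /f !patchE.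
  have -> // : ((x, y) \in A `*` B) = (y \in B).
  by apply/idP/idP => [/set_mem[_ /mem_set]//|/set_mem By]; apply/mem_set.
apply: integral0_eq => y _; rewrite /f patchE ifF//; apply/negbTE/negP => /set_mem [Ax _].
by apply: nAx; exact/mem_set.
Qed.

Let outer y : (\int[m1]_x f (x, y) = ((fun y => (\int[m1]_(x in A) F (x, y))%:E) \_ B) y)%E.
Proof.
rewrite patchE; case: ifPn => [/set_mem By|/negP nBy].
  rewrite (bRintegral_EFin mA fA (bmeas_slicer By bF)) [RHS]integral_mkcond.
  apply: eq_integral => x _; rewrite /f !patchE.
  have -> // : ((x, y) \in A `*` B) = (x \in A).
  by apply/idP/idP => [/set_mem[/mem_set]//|/set_mem Ax]; apply/mem_set.
apply: integral0_eq => x _; rewrite /f patchE ifF//; apply/negbTE/negP => /set_mem [_ By].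
by apply: nBy; exact/mem_set.
Qed.

Lemma bmeas_Rintegrall : bounded_measurable A (fun x => \int[m2]_(y in B) F (x, y)).
Proof.
split.
  apply/measurable_EFinP/(measurable_restrictT _ mA).
  by apply: eq_measurable_fun (measurable_fubini_F intf) => x _; rewrite /fubini_F inner.
case: (bF) => _ [M FM]; exists (M * fine (m2 B)) => x Ax.
apply: bRintegral_norm => //; last exact: bmeas_slicel.
by move=> y By; exact: FM.
Qed.

Lemma bmeas_Rintegralr : bounded_measurable B (fun y => \int[m1]_(x in A) F (x, y)).
Proof.
split.
  apply/measurable_EFinP/(measurable_restrictT _ mB).
  by apply: eq_measurable_fun (measurable_fubini_G intf) => y _; rewrite /fubini_G outer.
case: (bF) => _ [M FM]; exists (M * fine (m1 A)) => y By.
apply: bRintegral_norm => //; last exact: bmeas_slicer.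
by move=> x Ax; exact: FM.
Qed.

Lemma RFubinil : \int[(m1 \x m2)%E]_(p in A `*` B) F p =
  \int[m1]_(x in A) \int[m2]_(y in B) F (x, y).
Proof.
congr fine; rewrite integral_mkcond -[LHS](integral12_prod_meas1 intf) [RHS]integral_mkcond.
by apply: eq_integral => x _; rewrite /fubini_F inner.
Qed.

Lemma RFubinir : \int[(m1 \x m2)%E]_(p in A `*` B) F p =
  \int[m2]_(y in B) \int[m1]_(x in A) F (x, y).
Proof.
congr fine; rewrite integral_mkcond -[LHS](integral21_prod_meas1 intf) [RHS]integral_mkcond.
by apply: eq_integral => y _; rewrite /fubini_G outer.
Qed.
End fixed.

Hypotheses (A0 : (0 < m1 A)%E) (B0 : (0 < m2 B)%E).
Let a := fine (m1 A).
Let b := fine (m2 B).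
Let a0 : 0 < a. Proof. by rewrite /a fine_gt0// A0. Qed.
Let b0 : 0 < b. Proof. by rewrite /b fine_gt0// B0. Qed.

(** The variance of an average is at most the average of the variances. *)
Lemma variance_of_mean F : bounded_measurable (A `*` B) F ->
  \int[m1]_(x in A) ((\int[m2]_(y in B) F (x, y)) ^+ 2) -
    (\int[m1]_(x in A) \int[m2]_(y in B) F (x, y)) ^+ 2 / a <=
  b * \int[m2]_(y in B) (\int[m1]_(x in A) (F (x, y) ^+ 2) - (\int[m1]_(x in A) F (x, y)) ^+ 2 / a).
Proof.
move=> bF; rewrite -Rintegral_variance//; last exact: bmeas_Rintegrall.
set I := (\int[m1]_(x in A) \int[m2]_(y in B) F (x, y)).
pose mean y := (\int[m1]_(x in A) F (x, y)) / a.
have bmean : bounded_measurable B mean.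
  by rewrite /mean; under eq_fun do rewrite mulrC; apply: bmeasZ => //; exact: bmeas_Rintegralr.
pose H p := F p - mean p.2.
have bH : bounded_measurable (A `*` B) H.
  apply: bmeasD => //; have := bmeasZ (-1) (bmeas_snd bmean).
  by under eq_fun do rewrite mulN1r.
have Imean : I / a = \int[m2]_(y in B) mean y.
  rewrite /I -RFubinil// RFubinir// mulrC -bRintegralZ//; last exact: bmeas_Rintegralr.
  by apply: eq_Rintegral => y _; rewrite mulrC.
have GH x : A x -> \int[m2]_(y in B) F (x, y) - I / a = \int[m2]_(y in B) H (x, y).
  move=> Ax; rewrite Imean /H RintegralB//; apply: bmeas_integrable => //.
  exact: bmeas_slicel.
apply: le_trans (_ : \int[m1]_(x in A) (b * \int[m2]_(y in B) (H (x, y) ^+ 2)) <= _).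
  apply: bRintegral_le => //.
  - apply: bmeasX => //; apply: bmeasD => //; first exact: bmeas_Rintegrall.
    exact: bmeas_cst.
  - apply: bmeasZ => //; apply: (bmeas_Rintegrall (F := fun p => H p ^+ 2)).
    exact: bmeasX.
  - move=> x Ax; rewrite GH//; apply: Rintegral_sqr_le => //.
    exact: bmeas_slicel.
have bH2 : bounded_measurable (A `*` B) (fun p => H p ^+ 2) by exact: bmeasX.
rewrite bRintegralZ//; last exact: (bmeas_Rintegrall bH2).
rewrite ler_pM2l// -(RFubinil bH2) (RFubinir bH2).
rewrite le_eqVlt; apply/orP; left; apply/eqP; apply: eq_Rintegral => y /set_mem By.
by rewrite -Rintegral_variance//; exact: bmeas_slicer.
Qed.

(** Variances add up at most: a Poincare inequality holds on a product as soon as it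
    holds, with the same constant, in each factor. *)
Lemma poincare_product F G1 G2 : bounded_measurable (A `*` B) F ->
  bounded_measurable (A `*` B) G1 -> bounded_measurable (A `*` B) G2 ->
  (forall y, B y -> \int[m1]_(x in A) (F (x, y) ^+ 2) - (\int[m1]_(x in A) F (x, y)) ^+ 2 / a
     <= \int[m1]_(x in A) G1 (x, y)) ->
  (forall x, A x -> \int[m2]_(y in B) (F (x, y) ^+ 2) - (\int[m2]_(y in B) F (x, y)) ^+ 2 / b
     <= \int[m2]_(y in B) G2 (x, y)) ->
  \int[(m1 \x m2)%E]_(p in A `*` B) (F p ^+ 2)
    - (\int[(m1 \x m2)%E]_(p in A `*` B) F p) ^+ 2 / (a * b)
  <= \int[(m1 \x m2)%E]_(p in A `*` B) (G1 p + G2 p).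
Proof.
move=> bF bG1 bG2 h1 h2.
have bF2 : bounded_measurable (A `*` B) (fun p => F p ^+ 2) by exact: bmeasX.
rewrite bRintegralD// (RFubinil bF2) (RFubinil bF) (RFubinir bG1) (RFubinil bG2).
set G := fun x => \int[m2]_(y in B) F (x, y).
have bG : bounded_measurable A G by exact: bmeas_Rintegrall.
have bGs : bounded_measurable A (fun x => G x ^+ 2) by exact: bmeasX.
have bR2 : bounded_measurable A (fun x => \int[m2]_(y in B) G2 (x, y)) by exact: bmeas_Rintegrall.
have s1 : \int[m1]_(x in A) \int[m2]_(y in B) (F (x, y) ^+ 2) <=
    b^-1 * \int[m1]_(x in A) (G x ^+ 2) + \int[m1]_(x in A) \int[m2]_(y in B) G2 (x, y).
  rewrite -bRintegralZ// -bRintegralD//; last exact: bmeasZ.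
  apply: bRintegral_le => //; first exact: (bmeas_Rintegrall bF2).
    by apply: bmeasD => //; exact: bmeasZ.
  by move=> x Ax; have := h2 x Ax; rewrite lerBlDr addrC mulrC.
have s2 := variance_of_mean bF.
have s3 : \int[m2]_(y in B) (\int[m1]_(x in A) (F (x, y) ^+ 2) - (\int[m1]_(x in A) F (x, y)) ^+ 2 / a)
   <= \int[m2]_(y in B) \int[m1]_(x in A) G1 (x, y).
  apply: bRintegral_le => //; last exact: bmeas_Rintegralr.
  apply: bmeasD => //; first exact: (bmeas_Rintegralr bF2).
  under eq_fun do rewrite -mulNr mulrC -mulrN1 mulrA mulrC.
  do 2 apply: bmeasZ => //; apply: bmeasX => //; exact: bmeas_Rintegralr.
rewrite -/G in s2 *.
set P := \int[m1]_(x in A) \int[m2]_(y in B) (F (x, y) ^+ 2) in s1 *.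
set Q := \int[m1]_(x in A) (G x ^+ 2) in s1 s2.
set U := \int[m1]_(x in A) _ in s2 *.
set S := (X in _ <= X + _).
have s4 : b^-1 * Q <= U ^+ 2 / (a * b) + S.
  have {}s2 := le_trans s2 (ler_wpM2l (ltW b0) s3).
  rewrite lerBlDr -(ler_pM2l (_ : 0 < b^-1)) ?invr_gt0// in s2.
  apply: le_trans s2 _; rewrite le_eqVlt; apply/orP; left; apply/eqP.
  by rewrite -/S; field; rewrite !gt_eqF.
by rewrite lerBlDr; apply: le_trans s1 _; lra.
Qed.
End product.

(** * Integrals over a box *)

Section box.
Context {R : realType}.
Notation mu := (@lebesgue_measure R).
Notation box n := ((@rV_of_tuple R n) @^-1` (@cube R n)).
Notation leb n := (lebesgue_tuple R n).

Let I : set (measurableTypeR R) := [set` `]- pi, pi[].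

Let mI : measurable I. Proof. exact: measurable_itv. Qed.

Lemma lebesgue_period : mu I = (2 * pi)%:E.
Proof.
have p0 := pi_gt0 R.
by rewrite lebesgue_measure_itv/= lte_fin ifT -?EFinB; [congr _%:E; ring|lra].
Qed.

Let fI : (mu I < +oo)%E. Proof. by rewrite lebesgue_period ltry. Qed.
Let I0 : (0 < mu I)%E.
Proof. by rewrite lebesgue_period lte_fin mulr_gt0// pi_gt0. Qed.

Lemma boxE n : box n = [set t | forall i, I (tnth t i)].
Proof.
apply/seteqP; split=> t /= h i; first by rewrite /I/= in_itv/=; have := h i; rewrite mxE.
by rewrite mxE; have := h i; rewrite /I/= in_itv/=.
Qed.

Lemma measurable_box n : measurable (box n).
Proof.
rewrite boxE (_ : [set _ | _] =
    \bigcap_(i in [set: 'I_n]) ((tnth (T:=R))^~ i @^-1` I)); last first.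
  by apply/seteqP; split=> t /= h i; [move=> _; exact: h | exact: h].
apply: fin_bigcap_measurable => // i _.
by rewrite -[X in measurable X]setTI; exact: (@measurable_tnth _ _ n i).
Qed.

Lemma lebesgue_box n : leb n (box n) = ((2 * pi) ^+ n)%:E.
Proof.
rewrite boxE (@lebesgue_tuple_box R n (fun _ => I))//.
rewrite (eq_bigr (fun=> (2 * pi)%:E)) => [|i _]; last exact: lebesgue_period.
elim: n => [|n IH]; first by rewrite big_ord0 expr0.
by rewrite big_ord_recl IH exprS.
Qed.

Lemma lebesgue_box_fin n : (leb n (box n) < +oo)%E.
Proof. by rewrite lebesgue_box ltry. Qed.

Lemma lebesgue_box_gt0 n : (0 < leb n (box n))%E.
Proof. by rewrite lebesgue_box lte_fin exprn_gt0// mulr_gt0// pi_gt0. Qed.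

Definition box_integral n (F : n.-tuple R -> R) := \int[leb n]_(t in box n) F t.

Lemma box_cons n : @tuple_of_pair R n @^-1` box n.+1 = I `*` box n.
Proof.
rewrite !boxE; apply/seteqP; split=> -[x t] /=.
  move=> h; split=> [|i]; first exact: (h ord0).
  by have := h (lift ord0 i); rewrite tnthS.
move=> [Ix It] i; case: (unliftP ord0 i) => [j ->|-> //].
by rewrite /tuple_of_pair tnthS; exact: It.
Qed.

Lemma bmeas_box_cons n (F : n.+1.-tuple R -> R) : bounded_measurable (box n.+1) F ->
  bounded_measurable (I `*` box n) (fun p => F (tuple_of_pair p)).
Proof.
move=> [mF [M FM]]; split; last by exists M => p; rewrite -box_cons; exact: FM.
apply: (@measurable_comp _ _ _ _ _ _ (box n.+1) F _ (@tuple_of_pair R n)) => //.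
- exact: measurable_box.
- by move=> _ [p + <-]; rewrite -box_cons.
- by apply: measurable_funTS; exact: measurable_tuple_of_pair.
Qed.

Lemma box_integral_cons n (F : n.+1.-tuple R -> R) : bounded_measurable (box n.+1) F ->
  box_integral F = \int[(mu \x leb n)%E]_(p in I `*` box n) F (tuple_of_pair p).
Proof.
move=> bF; rewrite /box_integral /Rintegral; congr fine.
rewrite integral_mkcond -box_cons.
have pf := @integral_pushforward _ _ (measurableTypeR R * n.-tuple R)%type
  (n.+1.-tuple R) R (@tuple_of_pair R n) (measurable_tuple_of_pair (n:=n))
  (mu \x leb n)%E setT.
rewrite [LHS]pf//.
- rewrite [RHS]integral_mkcond preimage_setT; apply: eq_integral => p _.
  by rewrite /= !patchE.
- apply/(measurable_restrictT _ (@measurable_box n.+1)); apply/measurable_EFinP; exact: bF.1.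
- rewrite preimage_setT.
  have mIB := measurableX mI (@measurable_box n).
  have iF := bmeas_integrable mIB (product_set_fin mI (@measurable_box n) fI (lebesgue_box_fin n)) (bmeas_box_cons bF).
  apply: eq_integrable ((integrable_mkcond _ mIB).1 iF) => // p _.
  by rewrite -box_cons /= !patchE.
Qed.

Lemma bmeas_cons n (F : n.+1.-tuple R -> R) x : I x -> bounded_measurable (box n.+1) F ->
  bounded_measurable (box n) (fun t => F (cons_tuple x t)).
Proof.
move=> Ix bF; exact: (bmeas_slicel mI (@measurable_box n) Ix (bmeas_box_cons bF)).
Qed.

Lemma box_integral_cons_last n (F : n.+1.-tuple R -> R) : bounded_measurable (box n.+1) F ->
  box_integral F = \int[mu]_(x in I) box_integral (fun t => F (cons_tuple x t)).
Proof.
move=> bF; rewrite box_integral_cons// (RFubinil mI (@measurable_box n) fI (lebesgue_box_fin n))//.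
exact: bmeas_box_cons.
Qed.

Lemma box_integral_cons_first n (F : n.+1.-tuple R -> R) : bounded_measurable (box n.+1) F ->
  box_integral F = box_integral (fun t => \int[mu]_(x in I) F (cons_tuple x t)).
Proof.
move=> bF; rewrite box_integral_cons// (RFubinir mI (@measurable_box n) fI (lebesgue_box_fin n))//.
exact: bmeas_box_cons.
Qed.

Definition set_coord n (t : n.-tuple R) (i : 'I_n) (x : R) : n.-tuple R :=
  [tuple if j == i then x else tnth t j | j < n].

Lemma set_coord_cons0 n (t : n.-tuple R) (x y : R) :
  set_coord (cons_tuple y t) ord0 x = cons_tuple x t.
Proof.
apply: eq_from_tnth => j; rewrite tnth_mktuple.
by case: (unliftP ord0 j) => [k ->|->]; rewrite ?eqxx// eq_sym (negbTE (neq_lift _ _)) !tnthS.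
Qed.

Lemma set_coord_consS n (t : n.-tuple R) (x y : R) (i : 'I_n) :
  set_coord (cons_tuple y t) (lift ord0 i) x = cons_tuple y (set_coord t i x).
Proof.
apply: eq_from_tnth => j; rewrite tnth_mktuple.
case: (unliftP ord0 j) => [k ->|->]; last by rewrite (negbTE (neq_lift _ _)).
by rewrite !tnthS tnth_mktuple (inj_eq (@lift_inj _ ord0)).
Qed.

(** Only the restrictions of [F] to lines parallel to the [i]-th axis are constrained,
    so that the condition passes to slices in the induction on the dimension. *)
Definition sliced n (i : 'I_n) (F f : n.-tuple R -> R) :=
  forall t, box n t -> periodic_deriv1 (fun x => F (set_coord t i x)) (fun x => f (set_coord t i x)).

Lemma box_consP n x (t : n.-tuple R) : I x -> box n t -> box n.+1 (cons_tuple x t).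
Proof.
by move=> Ix Bt; rewrite -[_ (cons_tuple x t)]/((@tuple_of_pair R n @^-1` box n.+1) (x, t)) box_cons.
Qed.

Lemma sliced0 n (F f : n.+1.-tuple R -> R) t : sliced ord0 F f -> box n t ->
  periodic_deriv1 (fun x => F (cons_tuple x t)) (fun x => f (cons_tuple x t)).
Proof.
move=> Ff Bt; have I00 : I 0 by rewrite /I/= in_itv/= oppr_lt0 pi_gt0.
have := Ff _ (box_consP I00 Bt).
by under eq_fun do rewrite set_coord_cons0;
  under [X in periodic_deriv1 _ X]eq_fun do rewrite set_coord_cons0.
Qed.

Lemma slicedS n (F f : n.+1.-tuple R -> R) (i : 'I_n) y :
  sliced (lift ord0 i) F f -> I y ->
  sliced i (fun t => F (cons_tuple y t)) (fun t => f (cons_tuple y t)).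
Proof.
move=> Ff Iy t Bt; have := Ff _ (box_consP Iy Bt).
by under eq_fun do rewrite set_coord_consS;
  under [X in periodic_deriv1 _ X]eq_fun do rewrite set_coord_consS.
Qed.

Lemma Rintegral_per_cc (u : R -> R) : {within `[- pi, pi], continuous u} ->
  \int[mu]_(x in I) u x = \int[mu]_(x in `[- pi, pi]) u x.
Proof.
move=> cu; have iu := within_cont_integrable cu; have p0 := pi_ge0 R.
have iu1 : mu.-integrable `[- pi, pi[ (EFin \o u).
  by apply: integrableS iu => //; apply: subset_itvl; rewrite bnd_simp.
rewrite -(Rintegral_itv_bndo_bndc iu1) -Rintegral_itv_obnd_cbnd//.
by apply: integrableS iu1 => //; apply: subset_itvr; rewrite bnd_simp.
Qed.

(** Integrate first in the [i]-th coordinate. *)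
Lemma box_integral_derivative n (i : 'I_n) (F f : n.-tuple R -> R) :
  bounded_measurable (box n) f -> sliced i F f -> box_integral f = 0.
Proof.
elim: n i F f => [[]//|n IH] i F f bf Ff.
case: (unliftP ord0 i) Ff => [j ->|->] Ff.
  rewrite box_integral_cons_last// (@eq_Rintegral _ _ _ _ _ (fun=> 0)) => [|x /set_mem Ix].
    by rewrite Rintegral_cst// mul0r.
  exact: (IH j _ _ (bmeas_cons Ix bf) (slicedS Ff Ix)).
rewrite box_integral_cons_first// /box_integral (@eq_Rintegral _ _ _ _ _ (fun=> 0)) => [|t /set_mem Bt].
  by rewrite Rintegral_cst ?mul0r//; exact: measurable_box.
have [cu cv uv up] := sliced0 Ff Bt.
rewrite Rintegral_per_cc// (FTC_within _ cu cv uv).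
  by rewrite up subrr.
by have := pi_gt0 R; lra.
Qed.

(** Split off the first coordinate, to which the one-dimensional inequality applies. *)
Lemma box_integral_poincare n (F : n.-tuple R -> R) (f : 'I_n -> n.-tuple R -> R) :
  bounded_measurable (box n) F -> (forall i, bounded_measurable (box n) (f i)) ->
  (forall i, sliced i F (f i)) ->
  box_integral (fun t => F t ^+ 2) - box_integral F ^+ 2 / (2 * pi) ^+ n <= box_integral (fun t => \sum_i f i t ^+ 2).
Proof.
elim: n F f => [|n IH] F f bF bf Ff.
  have B0 : box 0 = setT by rewrite boxE; apply/seteqP; split=> // t _ [].
  have E (G : 0.-tuple R -> R) : bounded_measurable (box 0) G -> box_integral G = G [tuple].
    rewrite /box_integral B0 /Rintegral => -[mG _]; rewrite integral_dirac//; last first.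
      exact/measurable_EFinP.
    by rewrite diracT mul1e.
  rewrite !E//; last 2 first.
  - by apply: bmeas_sum => -[].
  - exact: bmeasX.
  by rewrite big_ord0 expr0 divr1 subrr.
have p0 := pi_gt0 R.
have bF2 : bounded_measurable (box n.+1) (fun t => F t ^+ 2) by exact: bmeasX.
have bf2 i : bounded_measurable (box n.+1) (fun t => f i t ^+ 2) by exact: bmeasX.
have bfs : bounded_measurable (box n.+1) (fun t => \sum_(i < n) f (lift ord0 i) t ^+ 2).
  by apply: bmeas_sum => i; exact: bf2.
have -> : box_integral (fun t => \sum_i f i t ^+ 2) =
    box_integral (fun t => f ord0 t ^+ 2 + \sum_(i < n) f (lift ord0 i) t ^+ 2).
  by apply: eq_Rintegral => t _; rewrite big_ord_recl.
rewrite !box_integral_cons//; last by exact: bmeasD.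
have := poincare_product mI (@measurable_box n) fI (lebesgue_box_fin n) I0
  (lebesgue_box_gt0 n) (bmeas_box_cons bF) (bmeas_box_cons (bf2 ord0)) (bmeas_box_cons bfs).
rewrite [fine (_ I)](_ : _ = 2 * pi); last by rewrite -[RHS]/(fine (2 * pi)%:E) -lebesgue_period.
rewrite lebesgue_box /= -exprS; apply.
- move=> t Bt; have [cu cv uv up] := sliced0 (Ff ord0) Bt.
  rewrite /tuple_of_pair/= !Rintegral_per_cc//; last 2 first.
  + exact: within_contX.
  + exact: within_contX.
  + exact: wirtinger.
- move=> x Ix; apply: IH => [|i|i].
  + exact: bmeas_cons.
  + exact: bmeas_cons.
  + exact: slicedS (Ff _) Ix.
Qed.
End box.

(** * Periodic functions on the cube and integration by parts *)

Local Notation Int := cube_Rintegral.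

Section periodic_calculus.
Context {R : realType} {d : nat}.
Notation rV := 'rV[R]_d.
Notation box := ((@rV_of_tuple R d) @^-1` (@cube R d)).
Notation leb := (lebesgue_tuple R d).
Notation ccube := (@closed_cube R d).
Implicit Types (f g u v : rV -> R) (x : rV).

Lemma cube_closed x : cube x -> closed_cube x.
Proof. by move=> h i; have /andP[a b] := h i; rewrite !ltW. Qed.

Definition cube_continuous f := {within ccube, continuous f}.

Lemma contP f : cube_continuous f <-> forall x, closed_cube x -> forall e : R, 0 < e ->
  exists2 r : R, 0 < r & forall y, closed_cube y ->
    (forall i, `|x 0 i - y 0 i| < r) -> `|f x - f y| < e.
Proof.
apply: (iff_trans (within_contP _ _)); split=> h x Cx e e0.
  have [r r0 hr] := h x Cx e e0; exists r => // y Cy xy; apply: hr => //.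
  by split=> // i j; rewrite ord1; exact: xy.
have [r r0 hr] := h x Cx e e0; exists r => // y Cy xy; apply: hr => // i.
exact: (xy.2 0 i).
Qed.

Lemma compact_closed_cube : compact ccube.
Proof.
rewrite [ccube](_ : _ = [set v : rV | forall i, [set` `[- pi, pi]] (v ord0 i)]).
  by apply: (@rV_compact R d (fun=> [set` `[- pi, pi]])) => i; exact: segment_compact.
by apply/seteqP; split=> x /= h i; have := h i; rewrite in_itv/=.
Qed.

Lemma cont_bounded f : cube_continuous f -> exists M, forall x, closed_cube x -> `|f x| <= M.
Proof.
move=> cf; have /compact_bounded[M [_ hM]] := continuous_compact cf compact_closed_cube.
exists (M + 1) => x Cx; apply: hM; first by rewrite ltrDl.
by exists x.
Qed.

Definition grid (k : nat) (z : {ffun 'I_d -> int}) : rV :=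
  \row_i Num.max (- pi) ((z i)%:~R / k.+1%:R).

Lemma measurable_grid k f :
  measurable_fun box (fun t => f (grid k [ffun i => Num.floor (tnth t i * k.+1%:R)])).
Proof.
move=> mB Y mY; apply: measurableI => //.
pose cell (z : {ffun 'I_d -> int}) : set (d.-tuple R) :=
  if f (grid k z) \in Y then
    \bigcap_(i in [set: 'I_d]) ((tnth (T:=R))^~ i @^-1`
      [set` `[(z i)%:~R / k.+1%:R, ((z i)%:~R + 1) / k.+1%:R[])
  else set0.
have k0 : 0 < k.+1%:R :> R by rewrite ltr0n.
rewrite [X in measurable X](_ : _ = \bigcup_(z in [set: {ffun 'I_d -> int}]) cell z).
  apply: countable_bigcupT_measurable => // z; rewrite /cell; case: ifP => // _.
  apply: fin_bigcap_measurable => // i _.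
  rewrite -[X in measurable X]setTI.
  by apply: (@measurable_tnth _ _ d i measurableT); exact: measurable_itv.
apply/seteqP; split=> t /=.
  move=> Yt; exists [ffun i => Num.floor (tnth t i * k.+1%:R)] => //.
  rewrite /cell mem_set// => i _ /=; rewrite in_itv/= ffunE.
  have /andP[f1 f2] := real_floor_itv (num_real (tnth t i * k.+1%:R)).
  by rewrite ler_pdivrMr// f1 ltr_pdivlMr//; move: f2; rewrite intrD.
move=> [z _]; rewrite /cell; case: ifPn => // /set_mem Yz h.
rewrite (_ : [ffun _ => _] = z)//; apply/ffunP => i; rewrite ffunE.
have := h i I; rewrite /= in_itv/= ler_pdivrMr// ltr_pdivlMr// => hz.
by apply: floor_def; rewrite intrD.
Qed.

(** Rounding the coordinates down to a grid, while keeping them at least [- pi] so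
    as to stay in the closed cube, approximates a continuous function by functions
    of countably many cells, which are measurable for the product sigma-algebra. *)
Lemma bmeas_cont f : cube_continuous f -> bounded_measurable box (fun t => f (rV_of_tuple t)).
Proof.
move=> cf; split; last first.
  have [M fM] := cont_bounded cf; exists M => t /cube_closed Ct; exact: fM.
apply: (measurable_fun_cvg (fun k => @measurable_grid k f)) => t Bt.
apply/cvgrPdist_lt => e e0.
have [r r0 hr] := (contP f).1 cf _ (cube_closed Bt) e e0.
near=> k; apply: hr.
  move=> i; rewrite !mxE ffunE le_max lexx/= ge_max; apply/andP; split.
    by have := pi_gt0 R; lra.
  rewrite ler_pdivrMr ?ltr0n//; apply: le_trans (real_floor_le (num_real _)) _.
  by have := Bt i; rewrite mxE ler_pM2r ?ltr0n// => /andP[_ /ltW].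
move=> i; rewrite !mxE ffunE.
have /andP[f1 f2] := real_floor_itv (num_real (tnth t i * k.+1%:R)).
have k0 : 0 < k.+1%:R :> R by rewrite ltr0n.
have kr : (k.+1%:R)^-1 < r by near: k; exact: near_infty_natSinv_lt (PosNum r0).
have {}f1 : (Num.floor (tnth t i * k.+1%:R))%:~R / k.+1%:R <= tnth t i by rewrite ler_pdivrMr.
have {}f2 : tnth t i - r < (Num.floor (tnth t i * k.+1%:R))%:~R / k.+1%:R.
  apply: (@lt_trans _ _ (tnth t i - k.+1%:R^-1)); first by rewrite ltrD2l ltrN2.
  rewrite ltr_pdivlMr// mulrBl mulVf ?gt_eqF// ltrBlDr.
  by move: f2; rewrite intrD.
have /andP[p1 p2] := Bt i; rewrite mxE in p1 p2.
rewrite ger0_norm ?subr_ge0 ?ge_max ?(ltW p1)//.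
by rewrite ltrBlDr -ltrBlDl lt_max f2 orbT.
Unshelve. all: by end_near. Qed.

Let mbox := @measurable_box R d.
Let fbox := @lebesgue_box_fin R d.

Lemma IntD f g : cube_continuous f -> cube_continuous g -> Int (fun x => f x + g x) = Int f + Int g.
Proof. by move=> /bmeas_cont bf /bmeas_cont bg; exact: bRintegralD. Qed.

Lemma IntZ (c : R) f : cube_continuous f -> Int (fun x => c * f x) = c * Int f.
Proof. by move=> /bmeas_cont bf; exact: bRintegralZ. Qed.

Lemma Int_ext f g : (forall x, cube x -> f x = g x) -> Int f = Int g.
Proof. by move=> fg; apply: eq_Rintegral => t /set_mem Bt; exact: fg. Qed.

Lemma Int_le f g : cube_continuous f -> cube_continuous g -> (forall x, cube x -> f x <= g x) ->
  Int f <= Int g.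
Proof.
by move=> /bmeas_cont bf /bmeas_cont bg fg; apply: (bRintegral_le mbox fbox bf bg) => t; exact: fg.
Qed.

Lemma Int_ge0 f : (forall x, cube x -> 0 <= f x) -> 0 <= Int f.
Proof. by move=> f0; apply: Rintegral_ge0 => t; exact: f0. Qed.

Lemma cont_cst (c : R) : cube_continuous (fun=> c). Proof. exact: within_cont_cst. Qed.

Lemma cont_sum (I : Type) (r : seq I) (F : I -> rV -> R) :
  (forall i, cube_continuous (F i)) -> cube_continuous (fun x => \sum_(i <- r) F i x).
Proof.
move=> cF; elim: r => [|i r IH].
  rewrite (_ : (fun x => _) = (fun=> 0)); first exact: cont_cst.
  by apply/funext => x; rewrite big_nil.
rewrite (_ : (fun x => _) = (fun x => F i x + \sum_(j <- r) F j x)).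
  by apply: within_contD => //; exact: cF.
by apply/funext => x; rewrite big_cons.
Qed.

Lemma Int_sum (I : Type) (r : seq I) (F : I -> rV -> R) : (forall i, cube_continuous (F i)) ->
  Int (fun x => \sum_(i <- r) F i x) = \sum_(i <- r) Int (F i).
Proof.
move=> cF; elim: r => [|i r IH].
  rewrite big_nil (@Int_ext _ (fun=> 0 * 0)) => [|x _]; last by rewrite big_nil mul0r.
  by rewrite IntZ ?mul0r//; exact: cont_cst.
rewrite big_cons -IH -IntD//; last exact: cont_sum.
by apply: Int_ext => x _; rewrite big_cons.
Qed.

Lemma cont_coord (h : R -> R) (j : 'I_d) : continuous h -> cube_continuous (fun x => h (x 0 j)).
Proof.
move=> ch; apply/contP => x _ e e0.
have /cvgrPdist_lt/(_ _ e0) := ch (x 0 j).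
move=> /nbhs_ballP[r /= r0 hr]; exists r => // y _ xy; apply: hr; exact: xy.
Qed.

Lemma cont_inv f : cube_continuous f -> (forall x, closed_cube x -> f x != 0) ->
  cube_continuous (fun x => (f x)^-1).
Proof.
move=> cf f0; apply/subspace_continuousP => x Cx.
apply: cvgV; first exact: f0.
by move/subspace_continuousP : cf; apply.
Qed.

Notation e_ i := (delta_mx 0 i : rV).

Definition deriv_in_cube (i : 'I_d) u v := forall x, cube x -> is_derive x (e_ i) u (v x).

Definition per_in (i : 'I_d) u := forall x y : rV, closed_cube x -> closed_cube y ->
  x 0 i = - pi -> y 0 i = pi -> (forall j, j != i -> x 0 j = y 0 j) -> u x = u y.

(** Continuity up to the boundary and equality of [u] on the two faces orthogonal to the
    [i]-th axis are what makes [v] integrate to zero. *)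
Definition is_per_deriv (i : 'I_d) u v :=
  [/\ cube_continuous u, cube_continuous v, deriv_in_cube i u v & per_in i u].

Lemma per_deriv_cont i u v : is_per_deriv i u v -> cube_continuous u. Proof. by case. Qed.

Lemma per_deriv_contD i u v : is_per_deriv i u v -> cube_continuous v. Proof. by case. Qed.

Lemma per_deriv_ext i u v u' v' : is_per_deriv i u v -> (forall x, u x = u' x) ->
  (forall x, v x = v' x) ->
  is_per_deriv i u' v'.
Proof. by move=> h /funext <- /funext <-. Qed.

Lemma per_deriv_cst i (c : R) : is_per_deriv i (fun=> c) (fun=> 0).
Proof. by split=> // [||x _]; [exact: cont_cst|exact: cont_cst|exact: derC]. Qed.

Lemma per_derivD i u v u' v' : is_per_deriv i u v -> is_per_deriv i u' v' ->
  is_per_deriv i (fun x => u x + u' x) (fun x => v x + v' x).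
Proof.
move=> [cu cv dv pu] [cu' cv' dv' pu']; split.
- exact: within_contD.
- exact: within_contD.
- by move=> x Cx; exact: derD (dv x Cx) (dv' x Cx).
- by move=> x y *; rewrite (pu x y)// (pu' x y).
Qed.

Lemma per_derivM i u v u' v' : is_per_deriv i u v -> is_per_deriv i u' v' ->
  is_per_deriv i (fun x => u x * u' x) (fun x => v x * u' x + u x * v' x).
Proof.
move=> [cu cv dv pu] [cu' cv' dv' pu']; split.
- exact: within_contM.
- by apply: within_contD; exact: within_contM.
- by move=> x Cx; exact: derM (dv x Cx) (dv' x Cx).
- by move=> x y *; rewrite (pu x y)// (pu' x y).
Qed.

Lemma per_derivZ i (c : R) u v : is_per_deriv i u v ->
  is_per_deriv i (fun x => c * u x) (fun x => c * v x).
Proof.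
by move=> h; apply: (per_deriv_ext (per_derivM (per_deriv_cst i c) h)) => x //; rewrite mul0r add0r.
Qed.

Lemma per_derivX i u v n : is_per_deriv i u v ->
  is_per_deriv i (fun x => u x ^+ n) (fun x => n%:R * u x ^+ n.-1 * v x).
Proof.
move=> [cu cv dv pu]; split.
- exact: within_contX.
- by do 2 apply: within_contM => //; [exact: cont_cst|exact: within_contX].
- by move=> x Cx; exact: derX (dv x Cx).
- by move=> x y *; rewrite (pu x y).
Qed.

Lemma per_derivV i u v : (forall x, closed_cube x -> u x != 0) -> is_per_deriv i u v ->
  is_per_deriv i (fun x => (u x)^-1) (fun x => - (u x)^-1 ^+ 2 * v x).
Proof.
move=> u0 [cu cv dv pu]; have cV := cont_inv cu u0; split => //.
- by apply: within_contM => //; apply: within_contN; exact: within_contX.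
- by move=> x Cx; apply: derV (dv x Cx); exact/u0/cube_closed.
- by move=> x y *; rewrite (pu x y).
Qed.

Lemma per_deriv_sum i (I : Type) (r : seq I) (u v : I -> rV -> R) :
  (forall k, is_per_deriv i (u k) (v k)) ->
  is_per_deriv i (fun x => \sum_(k <- r) u k x) (fun x => \sum_(k <- r) v k x).
Proof.
move=> uv; split.
- by apply: cont_sum => k; case: (uv k).
- by apply: cont_sum => k; case: (uv k).
- by move=> x Cx; apply: der_sum => k; case: (uv k) => _ _ + _; apply.
- by move=> x y *; apply: eq_bigr => k _; case: (uv k) => _ _ _; apply.
Qed.

(** A directional derivative only depends on the values along one line. *)
Lemma der_transfer (U W : normedModType R) (f : U -> R) (g : W -> R) (a v : U) (b w : W) (df : R) :
  (forall h : R, f (h *: v + a) = g (h *: w + b)) ->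
  is_derive a v f df -> is_derive b w g df.
Proof.
move=> fg [d1 d2].
have fg0 : f a = g b by have := fg 0; rewrite !scale0r !add0r.
have E : (fun h : R => h^-1 *: ((f \o shift a) (h *: v) - f a)) =
         (fun h : R => h^-1 *: ((g \o shift b) (h *: w) - g b)).
  by apply/funext => h /=; rewrite fg fg0.
split; first by move: d1; rewrite /derivable E.
by rewrite -d2 /derive E.
Qed.

Lemma per_deriv_coord i j (h dh : R -> R) : continuous h -> continuous dh ->
  (forall y : R, is_derive y 1 h (dh y)) -> h (- pi) = h pi ->
  is_per_deriv i (fun x => h (x 0 j)) (fun x => (i == j)%:R * dh (x 0 j)).
Proof.
move=> ch cdh hdh hp; split.
- exact: cont_coord.
- by apply: within_contM; [exact: cont_cst|exact: cont_coord].
- move=> x _; have [->|ij] := eqVneq i j; rewrite ?mul1r ?mul0r.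
    apply: der_transfer (hdh (x 0 j)) => k; rewrite !mxE !eqxx mulr1.
    by rewrite /GRing.scale /= mulr1.
  apply: der_transfer (derC (h (x 0 j)) x (e_ i)) => k.
  by rewrite !mxE eqxx eq_sym (negbTE ij) mulr0 add0r.
- move=> x y Cx Cy xi yi xy; have [<-|ij] := eqVneq i j; first by rewrite xi yi.
  by rewrite xy// eq_sym.
Qed.

Lemma per_deriv_slice i u v : is_per_deriv i u v ->
  sliced i (fun t => u (rV_of_tuple t)) (fun t => v (rV_of_tuple t)).
Proof.
move=> [cu cv dv pu] t Bt.
have p0 := pi_gt0 R.
have Bt' j : - pi < tnth t j < pi by have := Bt j; rewrite mxE.
have Cs (s : R) : - pi <= s <= pi -> closed_cube (rV_of_tuple (set_coord t i s)).
  move=> sp j; rewrite mxE tnth_mktuple; case: ifP => // _.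
  by have /andP[a b] := Bt' j; rewrite !ltW.
have cs f : cube_continuous f -> {within `[- pi, pi], continuous (fun s : R => f (rV_of_tuple (set_coord t i s)))}.
  move=> cf; apply/within_contP => x; rewrite /= in_itv/= => xp e e0.
  have [r r0 hr] := (contP f).1 cf _ (Cs _ xp) e e0.
  exists r => // y; rewrite /= in_itv/= => yp xy; apply: hr; first exact: Cs.
  move=> j; rewrite !mxE !tnth_mktuple; case: ifP => // _.
  by rewrite subrr normr0.
split; [exact: cs|exact: cs| |].
- move=> x; rewrite in_itv/= => xp.
  have Cx : cube (rV_of_tuple (set_coord t i x)).
    by move=> j; rewrite mxE tnth_mktuple; case: ifP.
  apply: der_transfer (dv _ Cx) => h; congr u; apply/rowP => j.
  rewrite !mxE !tnth_mktuple eqxx /GRing.scale /= mulr1.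
  by case: ifP => _; rewrite ?mulr1// mulr0 add0r.
- apply: pu.
  + by apply: Cs; lra.
  + by apply: Cs; lra.
  + by rewrite mxE tnth_mktuple eqxx.
  + by rewrite mxE tnth_mktuple eqxx.
  + by move=> j ji; rewrite !mxE !tnth_mktuple (negbTE ji).
Qed.

Lemma Int_per_deriv i u v : is_per_deriv i u v -> Int v = 0.
Proof.
move=> uv; apply: box_integral_derivative (per_deriv_slice uv).
by apply: bmeas_cont; exact: per_deriv_contD uv.
Qed.

Lemma Int_poincare u (v : 'I_d -> rV -> R) : cube_continuous u ->
  (forall i, is_per_deriv i u (v i)) ->
  Int u = 0 -> Int (fun x => u x ^+ 2) <= Int (fun x => \sum_i v i x ^+ 2).
Proof.
move=> cu uv u0.
have bv i : bounded_measurable box (fun t => v i (rV_of_tuple t)).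
  by apply: bmeas_cont; exact: per_deriv_contD (uv i).
have := box_integral_poincare (bmeas_cont cu) bv (fun i => per_deriv_slice (uv i)).
by rewrite [X in X ^+ 2]u0 expr0n mul0r subr0.
Qed.
End periodic_calculus.

(** * Families of partial derivatives *)

Section jets.
Context {R : realType} {d : nat}.
Notation rV := 'rV[R]_d.
Implicit Types (f g : rV -> R) (x : rV).

Notation e_ i := (delta_mx 0 i : rV).

Lemma cube_nbhs x : cube x -> exists2 r : R, 0 < r &
  forall y : rV, (forall i, `|x 0 i - y 0 i| < r) -> cube y.
Proof.
move=> Cx.
pose r := \big[Num.min/1]_(i < d) Num.min (pi - x 0 i) (x 0 i + pi).
have rle i : r <= Num.min (pi - x 0 i) (x 0 i + pi) by exact: bigmin_le_cond.
exists r.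
  apply/bigmin_gtP; split => // i _; rewrite lt_min.
  by have := Cx i; lra.
move=> y xy i; have := xy i; have := rle i; rewrite le_min ltr_norml; lra.
Qed.

Lemma nbhs_cube x : cube x -> nbhs x (@cube R d).
Proof.
move=> /cube_nbhs[r r0 hr]; apply/nbhs_ballP; exists r => // y xy.
by apply: hr => i; exact: (xy.2 0 i).
Qed.

Lemma is_derive_cube_uniq f g x v (a b : R) : cube x -> {in @cube R d, f =1 g} ->
  is_derive x v f a -> is_derive x v g b -> a = b.
Proof.
move=> Cx fg [_ <-] [_ <-]; have [->|v0] := eqVneq v 0; first by rewrite !derive0.
apply: near_eq_derive => //; apply: filterS (nbhs_cube Cx) => y Cy.
by apply: fg; exact/mem_set.
Qed.

(** A smooth function given with all its iterated derivatives: [u s] is the derivative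
    along the word [s], whose head is the outermost differentiation. *)
Definition jet (u : seq 'I_d -> rV -> R) := forall s i, is_per_deriv i (u s) (u (i :: s)).

Definition deriv_rect (h : R) (F G : R -> R -> R) := forall s t : R,
  0 <= s <= h -> 0 <= t <= h -> is_derive s 1 (fun z => F z t) (G s t).

(** Two applications of the mean value theorem to a mixed second difference. *)
Lemma second_difference (h : R) (F Fs Fst : R -> R -> R) : 0 < h ->
  deriv_rect h F Fs -> deriv_rect h (fun t s => Fs s t) (fun t s => Fst s t) ->
  exists st : R * R, [/\ 0 <= st.1 <= h, 0 <= st.2 <= h &
    F h h - F h 0 - (F 0 h - F 0 0) = Fst st.1 st.2 * h ^+ 2].
Proof.
move=> h0 dF dFs.
have h00 : 0 <= (0 : R) <= h by rewrite lexx ltW.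
have hh : 0 <= h <= h by rewrite lexx ltW.
pose phi s := F s h - F s 0.
have dphi s : 0 <= s <= h -> is_derive s 1 phi (Fs s h - Fs s 0).
  by move=> sh; exact: derD (dF s h sh hh) (derN (dF s 0 sh h00)).
have cphi : {within `[0, h], continuous phi}.
  apply: derivable_within_continuous => s; rewrite in_itv/= => sh.
  by case: (dphi s sh).
have [|s] := @MVT R phi (fun s => Fs s h - Fs s 0) 0 h h0 _ cphi.
  by move=> s; rewrite in_itv/= => /andP[s0 sh]; apply: dphi; rewrite !ltW.
rewrite in_itv/= subr0 => /andP[/ltW s0 /ltW sh] Es.
have s0h : 0 <= s <= h by rewrite s0.
have dpsi t : 0 <= t <= h -> is_derive t 1 (Fs s) (Fst s t).
  by move=> th; exact: dFs.
have cpsi : {within `[0, h], continuous (Fs s)}.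
  apply: derivable_within_continuous => t; rewrite in_itv/= => th.
  by case: (dpsi t th).
have [|t] := @MVT R (Fs s) (Fst s) 0 h h0 _ cpsi.
  by move=> t; rewrite in_itv/= => /andP[t0 th]; apply: dpsi; rewrite !ltW.
rewrite in_itv/= subr0 => /andP[/ltW t0 /ltW th] Et.
exists (s, t); split => /=; [exact: s0h|by rewrite t0|].
by rewrite -[LHS]/(phi h - phi 0) Es Et; ring.
Qed.

Let shift2 x (i j : 'I_d) (a b : R) : rV := a *: e_ i + (b *: e_ j + x).

Let shift2_near x i j (a b h : R) : 0 <= a <= h -> 0 <= b <= h ->
  forall k, `|x 0 k - shift2 x i j a b 0 k| <= 2 * h.
Proof.
move=> ah bh k; rewrite !mxE eqxx /=.
by case: (k == i); case: (k == j); rewrite /= ?mulr1 ?mulr0 ler_norml; lra.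
Qed.

Let shift2C x i j a b : shift2 x i j a b = shift2 x j i b a.
Proof. by rewrite /shift2 addrCA. Qed.

Let mixed_difference u (i j : 'I_d) x (h : R) : jet u -> 0 < h ->
  (forall y : rV, (forall k, `|x 0 k - y 0 k| <= 2 * h) -> cube y) ->
  exists2 y : rV, (forall k, `|x 0 k - y 0 k| <= 2 * h) &
    u [::] (shift2 x i j h h) - u [::] (shift2 x i j h 0)
     - (u [::] (shift2 x i j 0 h) - u [::] (shift2 x i j 0 0)) =
    u [:: j; i] y * h ^+ 2.
Proof.
move=> ju h0 hC.
have [| |[a b] [/= ah bh E]] := @second_difference h
  (fun a b => u [::] (shift2 x i j a b)) (fun a b => u [:: i] (shift2 x i j a b))
  (fun a b => u [:: j; i] (shift2 x i j a b)) h0.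
- move=> a b ah bh; have [_ _ du _] := ju [::] i.
  apply: der_transfer (du _ (hC _ (shift2_near x i j ah bh))) => k.
  by congr (u [::]); apply/rowP => l; rewrite /shift2 !mxE /GRing.scale /=; ring.
- move=> b a bh ah; have [_ _ du _] := ju [:: i] j.
  apply: der_transfer (du _ (hC _ (shift2_near x i j ah bh))) => k.
  by congr (u [:: i]); apply/rowP => l; rewrite /shift2 !mxE /GRing.scale /=; ring.
by exists (shift2 x i j a b) => // k; exact: shift2_near.
Qed.

(** Symmetry of second derivatives: both mixed derivatives, at points close to the
    given one, equal the same second difference quotient. *)
Lemma schwarz_nil u i j x : jet u -> cube x -> u [:: i; j] x = u [:: j; i] x.
Proof.
move=> ju Cx; have [r r0 hr] := cube_nbhs Cx.
apply/eqP; rewrite -subr_eq0 -normr_eq0 eq_le normr_ge0 andbT.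
apply/ler_addgt0Pl => e e0; rewrite addr0.
have e2 : 0 < e / 2 by lra.
have [_ c1 _ _] := ju [:: j] i; have [_ c2 _ _] := ju [:: i] j.
have [r1 r10 hr1] := (contP _).1 c1 x (cube_closed Cx) _ e2.
have [r2 r20 hr2] := (contP _).1 c2 x (cube_closed Cx) _ e2.
pose h := Num.min r (Num.min r1 r2) / 3.
have [m0 mr mr1 mr2] : [/\ 0 < Num.min r (Num.min r1 r2),
    Num.min r (Num.min r1 r2) <= r, Num.min r (Num.min r1 r2) <= r1
    & Num.min r (Num.min r1 r2) <= r2].
  by rewrite !lt_min r0 r10 r20 !ge_min !lexx !orbT.
have h0 : 0 < h by rewrite /h; lra.
have hC (y : rV) : (forall k, `|x 0 k - y 0 k| <= 2 * h) -> cube y.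
  by move=> xy; apply: hr => k; apply: le_lt_trans (xy k) _; rewrite /h; lra.
have [y xy Ey] := mixed_difference i j ju h0 hC.
have [z xz Ez] := mixed_difference j i ju h0 hC.
have Eyz : u [:: j; i] y = u [:: i; j] z.
  apply: (mulIf (_ : h ^+ 2 != 0)); first by rewrite expf_neq0// gt_eqF.
  by rewrite -Ey -Ez !(shift2C x j i); ring.
have n1 := hr1 z (cube_closed (hC z xz)) _.
have n2 := hr2 y (cube_closed (hC y xy)) _.
have -> : u [:: i; j] x - u [:: j; i] x =
  (u [:: i; j] x - u [:: i; j] z) - (u [:: j; i] x - u [:: j; i] y).
  by rewrite Eyz; ring.
apply: le_trans (ler_normB _ _) _; rewrite [leRHS]splitr lerD// ltW//.
  by apply: n1 => k; apply: le_lt_trans (xz k) _; rewrite /h; lra.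
by apply: n2 => k; apply: le_lt_trans (xy k) _; rewrite /h; lra.
Qed.

Lemma jet_cat u t : jet u -> jet (fun s => u (s ++ t)).
Proof. by move=> ju s i; exact: ju. Qed.

Lemma jet_swap u s1 i j s2 x : jet u -> cube x ->
  u (s1 ++ i :: j :: s2) x = u (s1 ++ j :: i :: s2) x.
Proof.
move=> ju; elim: s1 x => [|k s1 IH] x Cx.
  exact: (schwarz_nil i j (@jet_cat u s2 ju) Cx).
have [_ _ d1 _] := ju (s1 ++ i :: j :: s2) k.
have [_ _ d2 _] := ju (s1 ++ j :: i :: s2) k.
apply: is_derive_cube_uniq Cx _ (d1 x Cx) (d2 x Cx) => y /set_mem Cy.
exact: IH.
Qed.

Lemma jet_sum (I : Type) (r : seq I) (u : I -> seq 'I_d -> rV -> R) :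
  (forall k, jet (u k)) -> jet (fun s x => \sum_(k <- r) u k s x).
Proof. by move=> ju s i; apply: per_deriv_sum => k; exact: ju. Qed.

(** The new letter is the innermost differentiation, so it comes last. *)
Definition jet_partial (i : 'I_d) (u : seq 'I_d -> rV -> R) := fun s => u (s ++ [:: i]).

Definition jet_lap (u : seq 'I_d -> rV -> R) :=
  fun s x => \sum_(j < d) u (s ++ [:: j; j]) x.

Lemma jet_jet_partial i u : jet u -> jet (jet_partial i u).
Proof. exact: jet_cat. Qed.

Lemma jet_jet_lap u : jet u -> jet (jet_lap u).
Proof. by move=> ju; apply: jet_sum => j; exact: jet_cat. Qed.

Lemma jet_iter_lap m u : jet u -> jet (iter m jet_lap u).
Proof. by move=> ju; elim: m => //= m IH; exact: jet_jet_lap. Qed.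

Definition jet_eq (u v : seq 'I_d -> rV -> R) := forall s x, cube x -> u s x = v s x.

Lemma jet_lap_eq u v : jet_eq u v -> jet_eq (jet_lap u) (jet_lap v).
Proof. by move=> uv s x Cx; apply: eq_bigr => j _; exact: uv. Qed.

Lemma iter_lap_partial m i u : jet u ->
  jet_eq (iter m jet_lap (jet_partial i u)) (jet_partial i (iter m jet_lap u)).
Proof.
move=> ju; elim: m => [|m IH] s x Cx //=.
rewrite (jet_lap_eq IH)// /jet_lap /jet_partial; apply: eq_bigr => j _.
have jm := jet_iter_lap m ju.
rewrite -!catA /= -[s ++ [:: j; j; i]]/(s ++ [:: j] ++ [:: j; i]) catA (jet_swap _ _ _ _ jm)//.
by rewrite -catA /= (jet_swap _ _ _ _ jm).
Qed.
End jets.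

(** * The weights, and the weighted Hardy and Rellich inequalities *)

Section weights.
Context {R : realType} {d : nat}.
Notation rV := 'rV[R]_d.
Implicit Types (x : rV).

Definition domega2 (i : 'I_d) x : R := sin (x 0 i) / 2.
Definition ddomega2 (i : 'I_d) x : R := cos (x 0 i) / 2.
Definition omega2 x : R := \sum_(j < d) (2^-1 - ddomega2 j x).

(** [2 sin^2 (t / 2) = 1 - cos t]. *)
Lemma omega_sqr x : omega x ^+ 2 = omega2 x.
Proof.
rewrite /omega sqr_sqrtr; last by apply: sumr_ge0 => j _; exact: sqr_ge0.
apply: eq_bigr => j _; rewrite /ddomega2.
set y := x 0 j / 2; have -> : x 0 j = y + y by rewrite /y; field.
by rewrite cosD -!expr2 cos2sin2; field.
Qed.

Lemma omega2_ge0 x : 0 <= omega2 x. Proof. by rewrite -omega_sqr sqr_ge0. Qed.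

Lemma sum_ddomega2 x : \sum_(j < d) ddomega2 j x = d%:R / 2 - omega2 x.
Proof.
rewrite /omega2 sumrB sumr_const card_ord -[2^-1 *+ d]mulr_natl; ring.
Qed.

Lemma ddomega2_le x i : ddomega2 i x <= 2^-1.
Proof. by rewrite /ddomega2 ler_pdivrMr// mulVf ?cos_le1. Qed.

(** Each term is [sin^2 (x_i / 2) cos^2 (x_i / 2)], so at most [sin^2 (x_i / 2)]. *)
Lemma sum_domega2_sqr_le x : \sum_(j < d) domega2 j x ^+ 2 <= omega2 x.
Proof.
apply: ler_sum => j _; rewrite /domega2 /ddomega2 expr_div_n sin2cos2.
have := cos_le1 (x 0 j); have := cos_geN1 (x 0 j); set c := cos _ => c1 c2.
rewrite -subr_ge0 (_ : _ - _ = ((1 - c) / 2) ^+ 2); first exact: sqr_ge0.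
by field.
Qed.

Let c0 : continuous (fun y : R => sin y / 2).
Proof. by move=> y; apply: cvgM; [exact: continuous_sin|exact: cvg_cst]. Qed.
Let c1 : continuous (fun y : R => cos y / 2).
Proof. by move=> y; apply: cvgM; [exact: continuous_cos|exact: cvg_cst]. Qed.

Lemma per_deriv_domega2 i j : is_per_deriv i (domega2 j) (fun x => (i == j)%:R * ddomega2 j x).
Proof.
apply: (per_deriv_coord _ _ c0 c1) => [y|].
  by apply: (der_eq (derM (is_derive_sin y) (derC 2^-1 y 1))); ring.
by rewrite sinN !sinpi oppr0.
Qed.

Lemma per_deriv_ddomega2 i j : is_per_deriv i (ddomega2 j) (fun x => (i == j)%:R * - domega2 j x).
Proof.
have c2 : continuous (fun y : R => - (sin y / 2)) by move=> y; apply: cvgN; exact: c0.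
apply: (per_deriv_coord _ _ c1 c2) => [y|].
  by apply: (der_eq (derM (is_derive_cos y) (derC 2^-1 y 1))); ring.
by rewrite cosN.
Qed.

Lemma per_deriv_omega2 i : is_per_deriv i omega2 (domega2 i).
Proof.
apply: (per_deriv_ext (per_deriv_sum (index_enum 'I_d) (fun j =>
  per_derivD (per_deriv_cst i 2^-1) (per_derivZ (-1) (per_deriv_ddomega2 i j))))) => x.
  by apply: eq_bigr => j _; rewrite mulN1r.
rewrite (bigD1 i)//= eqxx mulr1n big1 => [|j /negbTE ji]; first by ring.
by rewrite eq_sym ji mulr0n; ring.
Qed.

Variable eps : R.
Hypothesis eps0 : 0 < eps.

(** A smooth substitute for [1 / omega^2], to which it increases when [eps] decreases
    to 0. *)
Definition regw x : R := (omega2 x + eps)^-1.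

Lemma omega2D_gt0 x : 0 < omega2 x + eps. Proof. by rewrite ltr_wpDl// omega2_ge0. Qed.

Lemma regw_gt0 x : 0 < regw x. Proof. by rewrite invr_gt0 omega2D_gt0. Qed.

(** [V = omega^2 + eps] satisfies [q V = 1] with [q = 1 / V]. *)
Lemma regw_omega2 x : regw x * omega2 x = 1 - regw x * eps.
Proof. by rewrite -[1](mulVf (lt0r_neq0 (omega2D_gt0 x))) -/(regw x); ring. Qed.

Lemma per_deriv_regw i : is_per_deriv i regw (fun x => - regw x ^+ 2 * domega2 i x).
Proof.
apply: (per_derivV (u := fun x => omega2 x + eps)) => [x _|]; first exact: lt0r_neq0 (omega2D_gt0 x).
by apply: (per_deriv_ext (per_derivD (per_deriv_omega2 i) (per_deriv_cst i eps))) => x //; rewrite addr0.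
Qed.

Lemma per_deriv_regwX i n : is_per_deriv i (fun x => regw x ^+ n)
  (fun x => - n%:R * regw x ^+ n.+1 * domega2 i x).
Proof.
apply: (per_deriv_ext (per_derivX n (per_deriv_regw i))) => x //.
by case: n => [|n]; rewrite ?mul0r ?oppr0 ?mul0r//= !exprS; ring.
Qed.

(** [|grad V|^2 <= V] for [V = omega^2 + eps]. *)
Lemma regw_domega2_le x : regw x ^+ 2 * \sum_(j < d) domega2 j x ^+ 2 <= regw x.
Proof.
have p0 := regw_gt0 x.
rewrite expr2 -mulrA -{3}[regw x]mulr1 ler_pM2l//.
apply: le_trans (ler_wpM2l (ltW p0) (sum_domega2_sqr_le x)) _.
by rewrite regw_omega2 gerBl mulr_ge0// ltW.
Qed.
End weights.

Lemma contD {R : realType} {d} (f g : 'rV[R]_d -> R) :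
  cube_continuous f -> cube_continuous g -> cube_continuous (fun x => f x + g x).
Proof. exact: within_contD. Qed.

Lemma contM {R : realType} {d} (f g : 'rV[R]_d -> R) :
  cube_continuous f -> cube_continuous g -> cube_continuous (fun x => f x * g x).
Proof. exact: within_contM. Qed.

Lemma contN {R : realType} {d} (f : 'rV[R]_d -> R) : cube_continuous f ->
  cube_continuous (fun x => - f x).
Proof. exact: within_contN. Qed.

Lemma contX {R : realType} {d} (f : 'rV[R]_d -> R) n : cube_continuous f ->
  cube_continuous (fun x => f x ^+ n).
Proof. exact: within_contX. Qed.

Section inequalities.
Context {R : realType} {d : nat}.
Notation rV := 'rV[R]_d.
Implicit Types (x : rV).
Variable eps : R.
Hypothesis eps0 : 0 < eps.
Notation regw := (@regw R d eps).

Lemma cont_regwX n : (0 < d)%N -> cube_continuous (fun x => regw x ^+ n).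
Proof. by move=> d0; exact: per_deriv_cont (per_deriv_regwX eps0 (Ordinal d0) n). Qed.

Hypothesis d0 : (0 < d)%N.

Lemma sum_sqr_affine (a b : 'I_d -> R) (t : R) :
  \sum_i (a i + t * b i) ^+ 2 =
  \sum_i a i ^+ 2 + 2 * t * (\sum_i a i * b i) + t ^+ 2 * \sum_i b i ^+ 2.
Proof. by rewrite !mulr_sumr -!big_split /=; apply: eq_bigr => i _; ring. Qed.

Section hardy.
Variables (k : nat) (b : R) (u : rV -> R) (du : 'I_d -> rV -> R).
Hypotheses (b0 : b < 0) (udu : forall i, is_per_deriv i u (du i)).

(* The divergence of [u^2 grad V / V^(k+1)]. *)
Let divG i x : R := ((i == i)%:R * ddomega2 i x) * (regw x ^+ k.+1 * u x ^+ 2) +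
  domega2 i x * ((- k.+1%:R * regw x ^+ k.+2 * domega2 i x) * u x ^+ 2 +
            regw x ^+ k.+1 * (2%:R * u x ^+ 1 * du i x)).

Let per_deriv_divG i : is_per_deriv i (fun x => domega2 i x * (regw x ^+ k.+1 * u x ^+ 2)) (divG i).
Proof. exact: per_derivM (per_deriv_domega2 i i) (per_derivM (per_deriv_regwX eps0 i k.+1) (per_derivX 2 (udu i))). Qed.

Let sum_divG x : \sum_i divG i x = regw x ^+ k * regw x * u x ^+ 2 * (d%:R / 2 - omega2 x)
  - (k%:R + 1) * regw x ^+ k * regw x ^+ 2 * u x ^+ 2 * (\sum_i domega2 i x ^+ 2)
  + 2 * regw x ^+ k * regw x * u x * (\sum_i du i x * domega2 i x).
Proof.
rewrite -sum_ddomega2 !mulr_sumr -sumrB -big_split /=; apply: eq_bigr => i _.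
by rewrite /divG eqxx mulr1n -natr1 !exprS; ring.
Qed.

Let pointwise x : h_ d k b * (regw x ^+ k.+1 * u x ^+ 2) + b * (regw x ^+ k * u x ^+ 2)
  <= regw x ^+ k * (\sum_i du i x ^+ 2) + (- b) * \sum_i divG i x.
Proof.
have p0 := regw_gt0 eps0 x; have pS := regw_domega2_le eps0 x; have pV := regw_omega2 eps0 x.
rewrite sum_divG.
have := sum_sqr_affine (du ^~ x) (domega2 ^~ x) (- b * regw x * u x).
set A := \sum_i du i x ^+ 2; set B := \sum_i du i x * domega2 i x.
move: pS; set S := \sum_i domega2 i x ^+ 2 => pS E.
have sq0 : 0 <= A + 2 * (- b * regw x * u x) * B + (- b * regw x * u x) ^+ 2 * S.
  by rewrite -E; apply: sumr_ge0 => i _; exact: sqr_ge0.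
have Q0 : 0 <= regw x ^+ k by rewrite exprn_ge0// ltW.
have t1 : 0 <= regw x ^+ k * (A + 2 * (- b * regw x * u x) * B + (- b * regw x * u x) ^+ 2 * S).
  exact: mulr_ge0.
have t2 : 0 <= regw x ^+ k * u x ^+ 2 * ((b ^+ 2 - b * (k%:R + 1)) * (regw x - regw x ^+ 2 * S)).
  apply: mulr_ge0; first by rewrite mulr_ge0 ?sqr_ge0.
  apply: mulr_ge0; last by rewrite subr_ge0.
  by rewrite addr_ge0 ?sqr_ge0// -mulNr mulr_ge0 ?oppr_ge0 ?(ltW b0)// addr_ge0.
have t3 : 0 <= regw x ^+ k * u x ^+ 2 * (- b * (regw x * eps)).
  apply: mulr_ge0; first by rewrite mulr_ge0 ?sqr_ge0.
  by rewrite mulr_ge0 ?oppr_ge0 ?(ltW b0)// mulr_ge0// ltW.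
rewrite -subr_ge0; apply: le_trans (addr_ge0 (addr_ge0 t1 t2) t3) _.
rewrite le_eqVlt; apply/orP; left; apply/eqP.
have -> : regw x * eps = 1 - regw x * omega2 x by rewrite pV; ring.
by rewrite /h_ [regw x ^+ k.+1]exprS; field.
Qed.

(** With [V = omega^2 + eps], integrate the square [|grad u - b u grad V / V|^2 / V^k]
    and move its cross term onto the weight. *)
Lemma weighted_hardy :
  h_ d k b * Int (fun x => regw x ^+ k.+1 * u x ^+ 2) + b * Int (fun x => regw x ^+ k * u x ^+ 2)
  <= Int (fun x => regw x ^+ k * \sum_i du i x ^+ 2).
Proof.
have cu : cube_continuous u := per_deriv_cont (udu (Ordinal d0)).
have cdu i : cube_continuous (du i) := per_deriv_contD (udu i).
have cA : cube_continuous (fun x => regw x ^+ k * \sum_i du i x ^+ 2).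
  by apply: contM; [exact: cont_regwX|apply: cont_sum => i; exact: contX].
have cG : cube_continuous (fun x => \sum_i divG i x).
  by apply: cont_sum => i; exact: per_deriv_contD (per_deriv_divG i).
have c1 : cube_continuous (fun x => regw x ^+ k.+1 * u x ^+ 2).
  by apply: contM; [exact: cont_regwX|exact: contX].
have c2 : cube_continuous (fun x => regw x ^+ k * u x ^+ 2).
  by apply: contM; [exact: cont_regwX|exact: contX].
have IG : Int (fun x => \sum_i divG i x) = 0.
  rewrite Int_sum => [|i]; last exact: per_deriv_contD (per_deriv_divG i).
  by apply: big1 => i _; exact: Int_per_deriv (per_deriv_divG i).
have -> : Int (fun x => regw x ^+ k * \sum_i du i x ^+ 2) =
    Int (fun x => regw x ^+ k * \sum_i du i x ^+ 2 + (- b) * \sum_i divG i x).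
  rewrite IntD// ?IntZ// ?IG ?mulr0 ?addr0//.
  by apply: contM => //; exact: cont_cst.
rewrite -!IntZ// -IntD//; [|by apply: contM => //; exact: cont_cst..].
apply: Int_le => [||x _]; last exact: pointwise.
  by apply: contD; apply: contM => //; exact: cont_cst.
by apply: contD => //; apply: contM => //; exact: cont_cst.
Qed.
End hardy.

Section bochner.
Variables (k : nat) (u : seq 'I_d -> rV -> R).
Hypothesis ju : jet u.

Let w x : R := regw x ^+ k.
Let dw i x : R := - k%:R * regw x ^+ k.+1 * domega2 i x.
Let ddw i j x : R := (- k%:R * (- k.+1%:R * regw x ^+ k.+2 * domega2 i x)) * domega2 j x
  + (- k%:R * regw x ^+ k.+1) * ((i == j)%:R * ddomega2 j x).

Let per_deriv_w i : is_per_deriv i w (dw i). Proof. exact: per_deriv_regwX. Qed.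

Let per_deriv_dw i j : is_per_deriv i (dw j) (ddw i j).
Proof. exact: per_derivM (per_derivZ (- k%:R) (per_deriv_regwX eps0 i k.+1)) (per_deriv_domega2 i j). Qed.

Let cu s : cube_continuous (u s). Proof. exact: per_deriv_cont (ju s (Ordinal d0)). Qed.

(* The combination [E] of derivatives below integrates to 0, and is chosen so that the
   third derivatives of [u] cancel in it. *)
Let E1 i j x : R := dw i x * (u [:: i] x * u [:: j; j] x) +
  w x * (u [:: i; i] x * u [:: j; j] x + u [:: i] x * u [:: i; j; j] x).
Let E2 i j x : R := dw j x * (u [:: i] x * u [:: i; j] x) +
  w x * (u [:: j; i] x * u [:: i; j] x + u [:: i] x * u [:: j; i; j] x).
Let E3 i j x : R := ddw j i x * (u [:: i] x * u [:: j] x) +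
  dw i x * (u [:: j; i] x * u [:: j] x + u [:: i] x * u [:: j; j] x).
Let E4 i j x : R := ddw j j x * u [:: i] x ^+ 2 +
  dw j x * (2%:R * u [:: i] x ^+ 1 * u [:: j; i] x).
Let E i j x : R := E1 i j x - E2 i j x - E3 i j x + E4 i j x.

Let D1 i j : is_per_deriv i (fun x => w x * (u [:: i] x * u [:: j; j] x)) (E1 i j).
Proof. exact: per_derivM (per_deriv_w i) (per_derivM (ju [:: i] i) (ju [:: j; j] i)). Qed.

Let D2 i j : is_per_deriv j (fun x => w x * (u [:: i] x * u [:: i; j] x)) (E2 i j).
Proof. exact: per_derivM (per_deriv_w j) (per_derivM (ju [:: i] j) (ju [:: i; j] j)). Qed.

Let D3 i j : is_per_deriv j (fun x => dw i x * (u [:: i] x * u [:: j] x)) (E3 i j).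
Proof. exact: per_derivM (per_deriv_dw j i) (per_derivM (ju [:: i] j) (ju [:: j] j)). Qed.

Let D4 i j : is_per_deriv j (fun x => dw j x * u [:: i] x ^+ 2) (E4 i j).
Proof. exact: per_derivM (per_deriv_dw j j) (per_derivX 2 (ju [:: i] j)). Qed.

Let cE i j : cube_continuous (E i j).
Proof.
apply: contD (per_deriv_contD (D4 i j)); apply: contD; last exact: contN (per_deriv_contD (D3 i j)).
by apply: contD (per_deriv_contD (D1 i j)) _; exact: contN (per_deriv_contD (D2 i j)).
Qed.

Let IE i j : Int (E i j) = 0.
Proof.
have c1 := per_deriv_contD (D1 i j); have c2 := per_deriv_contD (D2 i j).
have c3 := per_deriv_contD (D3 i j); have c4 := per_deriv_contD (D4 i j).
rewrite (@Int_ext _ _ _ (fun x => E1 i j x + (-1) * E2 i j x + (-1) * E3 i j x + E4 i j x)).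
  have k2 : cube_continuous (fun x => (-1) * E2 i j x) by apply: contM c2; exact: cont_cst.
  have k3 : cube_continuous (fun x => (-1) * E3 i j x) by apply: contM c3; exact: cont_cst.
  rewrite (IntD (contD (contD c1 k2) k3) c4) (IntD (contD c1 k2) k3) (IntD c1 k2).
  rewrite (IntZ _ c2) (IntZ _ c3) (Int_per_deriv (D1 i j)) (Int_per_deriv (D2 i j)).
  by rewrite (Int_per_deriv (D3 i j)) (Int_per_deriv (D4 i j)) !mulr0 !addr0.
by move=> x _; rewrite /E; ring.
Qed.

Let pointwise x : cube x ->
  w x * (\sum_j u [:: j; j] x) ^+ 2 - w x * (\sum_i \sum_j u [:: j; i] x ^+ 2)
    - \sum_i \sum_j E i j x =
  \sum_i \sum_j ddw j i x * (u [:: i] x * u [:: j] x)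
    - (\sum_j ddw j j x) * \sum_i u [:: i] x ^+ 2.
Proof.
move=> Cx.
have s2 i j : u [:: i; j] x = u [:: j; i] x by exact: schwarz_nil.
have s3 i j : u [:: i; j; j] x = u [:: j; i; j] x by exact: (jet_swap [::]).
pose T i j : R := dw i x * (u [:: j; i] x * u [:: j] x).
have T0 : \sum_i \sum_j (T i j - T j i) = 0.
  rewrite (eq_bigr (fun i => \sum_j T i j - \sum_j T j i)) => [|i _]; last by rewrite sumrB.
  by rewrite sumrB [X in _ - X]exchange_big subrr.
have -> : w x * (\sum_j u [:: j; j] x) ^+ 2 =
    \sum_i \sum_j w x * (u [:: i; i] x * u [:: j; j] x).
  by rewrite expr2 big_distrlr /= mulr_sumr; apply: eq_bigr => i _; rewrite mulr_sumr.
have -> : w x * (\sum_i \sum_j u [:: j; i] x ^+ 2) =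
    \sum_i \sum_j w x * u [:: j; i] x ^+ 2.
  by rewrite mulr_sumr; apply: eq_bigr => i _; rewrite mulr_sumr.
have -> : (\sum_j ddw j j x) * \sum_i u [:: i] x ^+ 2 =
    \sum_i \sum_j ddw j j x * u [:: i] x ^+ 2.
  by rewrite big_distrlr /= exchange_big.
rewrite -[RHS]addr0 -[X in _ = _ + X]T0 -!sumrB -big_split /=; apply: eq_bigr => i _.
rewrite -!sumrB -big_split /=; apply: eq_bigr => j _.
rewrite /T /E /E1 /E2 /E3 /E4 (s3 i j) (s2 i j) expr1; ring.
Qed.

Let lower x :
  (k%:R * (d%:R - 2 * k%:R - 3) / 2) * (regw x ^+ k.+1 * \sum_i u [:: i] x ^+ 2)
    - k%:R * (regw x ^+ k * \sum_i u [:: i] x ^+ 2) <=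
  \sum_i \sum_j ddw j i x * (u [:: i] x * u [:: j] x)
    - (\sum_j ddw j j x) * \sum_i u [:: i] x ^+ 2.
Proof.
have p0 := regw_gt0 eps0 x; have pS := regw_domega2_le eps0 x; have pV := regw_omega2 eps0 x.
pose B := \sum_i domega2 i x * u [:: i] x.
pose C := \sum_i ddomega2 i x * u [:: i] x ^+ 2.
pose A := \sum_i u [:: i] x ^+ 2.
rewrite -/A; move: pS; set S := \sum_i domega2 i x ^+ 2 => pS.
have Edd : \sum_j ddw j j x = k%:R * (k%:R + 1) * regw x ^+ k * regw x ^+ 2 * S
    - k%:R * regw x ^+ k * regw x * (d%:R / 2 - omega2 x).
  rewrite -sum_ddomega2 !mulr_sumr -sumrB; apply: eq_bigr => j _.
  by rewrite /ddw eqxx mulr1n -natr1 !exprS; ring.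
have Edu : \sum_i \sum_j ddw j i x * (u [:: i] x * u [:: j] x) =
    k%:R * (k%:R + 1) * regw x ^+ k * regw x ^+ 2 * B ^+ 2 - k%:R * regw x ^+ k * regw x * C.
  rewrite [B ^+ 2]expr2 big_distrlr /= !mulr_sumr -sumrB; apply: eq_bigr => i _.
  rewrite mulr_sumr (bigD1 i)//= [in RHS](bigD1 i)//= [RHS]addrAC; congr (_ + _).
    by rewrite /ddw eqxx mulr1n -natr1 !exprS; ring.
  apply: eq_bigr => j /negbTE ji; by rewrite /ddw ji mulr0n -natr1 !exprS; ring.
rewrite Edd Edu.
have CA : C <= A / 2.
  rewrite /C /A mulr_suml; apply: ler_sum => i _.
  by rewrite mulrC ler_wpM2l ?sqr_ge0 ?ddomega2_le.
have A0 : 0 <= A by apply: sumr_ge0 => i _; exact: sqr_ge0.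
have Q0 : 0 <= regw x ^+ k by rewrite exprn_ge0// ltW.
have K0 : 0 <= k%:R * regw x ^+ k by rewrite mulr_ge0.
have t1 : 0 <= k%:R * regw x ^+ k * (regw x * (A / 2 - C)).
  by rewrite mulr_ge0// mulr_ge0 ?subr_ge0// ltW.
have t2 : 0 <= k%:R * regw x ^+ k * ((k%:R + 1) * (A * (regw x - regw x ^+ 2 * S))).
  by rewrite mulr_ge0// mulr_ge0 ?addr_ge0// mulr_ge0// subr_ge0.
have t3 : 0 <= k%:R * regw x ^+ k * ((k%:R + 1) * (regw x ^+ 2 * B ^+ 2)).
  by rewrite mulr_ge0// mulr_ge0 ?addr_ge0// mulr_ge0 ?sqr_ge0.
have t4 : 0 <= k%:R * regw x ^+ k * (A * (regw x * eps)).
  by rewrite mulr_ge0// mulr_ge0// mulr_ge0// ltW.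
rewrite -subr_ge0; apply: le_trans (addr_ge0 (addr_ge0 t1 t2) (addr_ge0 t3 t4)) _.
rewrite le_eqVlt; apply/orP; left; apply/eqP.
have -> : regw x * eps = 1 - regw x * omega2 x by rewrite pV; ring.
by rewrite [regw x ^+ k.+1]exprS; field.
Qed.

(** Integrating by parts twice turns the squared Laplacian into the squared Hessian;
    what is left over only involves the Hessian of the weight. *)
Lemma weighted_bochner :
  (k%:R * (d%:R - 2 * k%:R - 3) / 2) * Int (fun x => regw x ^+ k.+1 * \sum_i u [:: i] x ^+ 2)
    - k%:R * Int (fun x => regw x ^+ k * \sum_i u [:: i] x ^+ 2)
    + \sum_i Int (fun x => regw x ^+ k * \sum_j u [:: j; i] x ^+ 2) <=
  Int (fun x => regw x ^+ k * (\sum_j u [:: j; j] x) ^+ 2).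
Proof.
have cA : cube_continuous (fun x => \sum_i u [:: i] x ^+ 2) by apply: cont_sum => i; exact: contX.
have c1 : cube_continuous (fun x => regw x ^+ k.+1 * \sum_i u [:: i] x ^+ 2) by apply: contM => //; exact: cont_regwX.
have c2 : cube_continuous (fun x => regw x ^+ k * \sum_i u [:: i] x ^+ 2) by apply: contM => //; exact: cont_regwX.
have c3 i : cube_continuous (fun x => regw x ^+ k * \sum_j u [:: j; i] x ^+ 2).
  by apply: contM; [exact: cont_regwX|apply: cont_sum => j; exact: contX].
have c4 : cube_continuous (fun x => \sum_i (regw x ^+ k * \sum_j u [:: j; i] x ^+ 2)) by exact: cont_sum.
have cE2 : cube_continuous (fun x => \sum_i \sum_j E i j x).
  by apply: cont_sum => i; apply: cont_sum => j; exact: cE.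
have IE2 : Int (fun x => \sum_i \sum_j E i j x) = 0.
  rewrite Int_sum => [|i]; last by apply: cont_sum => j; exact: cE.
  apply: big1 => i _; rewrite Int_sum => [|j]; last exact: cE.
  by apply: big1 => j _; exact: IE.
rewrite -Int_sum// -[- (_ * Int _)]mulNr -!IntZ//.
have z1 : cube_continuous (fun x => (k%:R * (d%:R - 2 * k%:R - 3) / 2) *
    (regw x ^+ k.+1 * \sum_i u [:: i] x ^+ 2)) by apply: contM c1; exact: cont_cst.
have z2 : cube_continuous (fun x => - k%:R * (regw x ^+ k * \sum_i u [:: i] x ^+ 2)).
  by apply: contM c2; exact: cont_cst.
rewrite -(IntD z1 z2) -(IntD (contD z1 z2) c4) -[leLHS]addr0 -[X in _ + X <= _]IE2.
rewrite -(IntD (contD (contD z1 z2) c4) cE2).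
apply: Int_le => [||x Cx].
- by do 2 apply: contD => //; exact: contD.
- by apply: contM; [exact: cont_regwX|apply: contX; exact: cont_sum].
rewrite -lerBrDr -lerBrDr -mulr_sumr.
have -> : regw x ^+ k * (\sum_j u [:: j; j] x) ^+ 2 - \sum_i \sum_j E i j x
    - regw x ^+ k * (\sum_i \sum_j u [:: j; i] x ^+ 2) =
  w x * (\sum_j u [:: j; j] x) ^+ 2 - w x * (\sum_i \sum_j u [:: j; i] x ^+ 2)
    - \sum_i \sum_j E i j x by rewrite /w; ring.
by rewrite pointwise//; have := lower x; rewrite mulNr.
Qed.
End bochner.

Lemma weighted_rellich (k : nat) (a : R) (u : seq 'I_d -> rV -> R) : a < 0 -> jet u ->
  r_ d k a * Int (fun x => regw x ^+ k.+1 * \sum_i u [:: i] x ^+ 2) <=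
  Int (fun x => regw x ^+ k * (\sum_j u [:: j; j] x) ^+ 2)
    + (k%:R - a) * Int (fun x => regw x ^+ k * \sum_i u [:: i] x ^+ 2).
Proof.
move=> a0 ju; have B := weighted_bochner k ju.
have cu s : cube_continuous (u s) by exact: per_deriv_cont (ju s (Ordinal d0)).
have split n : Int (fun x => regw x ^+ n * \sum_i u [:: i] x ^+ 2) =
    \sum_i Int (fun x => regw x ^+ n * u [:: i] x ^+ 2).
  rewrite -Int_sum => [|i]; last by apply: contM; [exact: cont_regwX|exact: contX].
  by apply: Int_ext => x _; rewrite mulr_sumr.
have H : h_ d k a * Int (fun x => regw x ^+ k.+1 * \sum_i u [:: i] x ^+ 2)
    + a * Int (fun x => regw x ^+ k * \sum_i u [:: i] x ^+ 2) <=
    \sum_i Int (fun x => regw x ^+ k * \sum_j u [:: j; i] x ^+ 2).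
  rewrite !split !mulr_sumr -big_split /=; apply: ler_sum => i _.
  exact: (weighted_hardy k a0 (fun j => ju [:: i] j)).
move: B H; rewrite /r_.
set X := Int _; set Y := Int _; set Z := Int _; set S := \sum_i _.
move=> B H; have := lerD B H.
by rewrite -subr_ge0 => t; rewrite -subr_ge0; apply: le_trans t _;
  rewrite le_eqVlt; apply/orP; left; apply/eqP; ring.
Qed.
End inequalities.

(** * The recursion on the order *)

Section constants_theory.
Context {R : realType} {d : nat}.

(** The two ways in which the suprema defining the constants are used: as positive
    numbers, and as optimal constants of a family of inequalities. *)
Lemma sup_posP (S : set R) (x M : R) : S x -> 0 < x -> (forall y, S y -> y <= M) ->
  0 < sup S /\ forall A X, 0 <= A -> 0 <= X -> (forall y, S y -> y * X <= A) -> sup S * X <= A.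
Proof.
move=> Sx x0 SM; split.
  apply: lt_le_trans x0 _; apply: ub_le_sup => //; exists M => y; exact: SM.
move=> A X A0 X0 SA; have [->|Xn0] := eqVneq X 0; first by rewrite mulr0.
have {Xn0}X0 : 0 < X by rewrite lt_def Xn0.
rewrite -ler_pdivlMr//; apply: ge_sup; first by exists x.
by move=> y Sy; rewrite ler_pdivlMr//; exact: SA.
Qed.

Lemma h_le k (b : R) : h_ d k b <= (d%:R - 2 * k%:R - 2) ^+ 2 / 16.
Proof.
rewrite -subr_ge0 /h_; set c := _ - 2.
rewrite (_ : _ - _ = (c / 4 + b) ^+ 2); first exact: sqr_ge0.
by field.
Qed.

(** Any negative number close enough to 0 makes [h_] and [r_] positive; [- 1/4] is close
    enough as soon as [d > 2 k + 2]. *)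
Lemma h_quarter k : (2 * k.+1 < d)%N -> 0 < h_ d k (- 4^-1 : R).
Proof.
move=> kd; have : 2 * (k%:R + 1) + 1 <= d%:R :> R.
  by rewrite !natr1 -natrM natr1 ler_nat.
by rewrite /h_; lra.
Qed.

Lemma r_quarter k : (2 * k.+2 < d)%N -> 0 < r_ d k (- 4^-1 : R).
Proof.
move=> kd; rewrite /r_ ltr_wpDr ?h_quarter//; last by apply: leq_ltn_trans kd; rewrite leq_mul2l leqnSn.
have : 2 * (k%:R + 2) + 1 <= d%:R :> R.
  by rewrite -natrD -natrM natr1 ler_nat addn2.
by move=> dk; rewrite divr_ge0// mulr_ge0//; lra.
Qed.

Lemma admissible_quarter m : (2 * m.+2 < d)%N ->
  @admissible R d m.+2 (- 4^-1, - 4^-1).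
Proof.
move=> md; rewrite /admissible /= !subn1 !subn2 /=.
by split; rewrite ?oppr_lt0 ?invr_gt0//; [exact: r_quarter|exact: h_quarter].
Qed.

Lemma K_odd m : odd m -> K_ R d m.+2 = K_ R d m.+1 *
  sup [set h_ d m.+1 ab.2 / (1 - ab.2) | ab in @admissible R d m.+2].
Proof. by move=> om; rewrite /K_ -/K_ /= om /= subn1. Qed.

Lemma K_even m : ~~ odd m -> K_ R d m.+2 =
  sup [set r_ d m ab.1 * h_ d m.+1 ab.2 /
    ((- ab.1 + m.+1%:R) / K_ R d m - ab.2 * (r_ d m ab.1 / K_ R d m.+1))
    | ab in @admissible R d m.+2].
Proof. by move=> om; rewrite /K_ -/K_ /= (negbTE om) /= subn1 subn2. Qed.

Lemma K_odd_sup m : odd m -> (2 * m.+2 < d)%N -> 0 < K_ R d m.+1 ->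
  0 < K_ R d m.+2 /\ forall A X : R, 0 <= A -> 0 <= X ->
    (forall b, b < 0 -> K_ R d m.+1 * h_ d m.+1 b * X <= (1 - b) * A) ->
    K_ R d m.+2 * X <= A.
Proof.
move=> om md K0; rewrite K_odd//.
set S := [set _ | _ in _].
have Sx : S (h_ d m.+1 (- 4^-1) / (1 - - 4^-1)).
  by exists (- 4^-1, - 4^-1) => //; exact: admissible_quarter.
have x0 : 0 < h_ d m.+1 (- 4^-1) / (1 - - 4^-1) :> R.
  by rewrite divr_gt0 ?h_quarter//; lra.
have [] := sup_posP (M := (d%:R - 2 * m.+1%:R - 2) ^+ 2 / 16) Sx x0.
  move=> y [[a b]] /= [/= _ b0 _]; rewrite subn1/= => h0 <-.
  apply: le_trans (h_le m.+1 b); rewrite ler_pdivrMr; last by lra.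
  by rewrite ler_peMr ?(ltW h0)//; lra.
move=> S0 hS; split; first exact: mulr_gt0.
move=> A X A0 X0 hA; rewrite [_ * sup S]mulrC -mulrA; apply: hS => //.
  by rewrite mulr_ge0// ltW.
move=> y [[a b]] /= [/= _ b0 _]; rewrite subn1/= => h0 <-.
rewrite mulrAC ler_pdivrMr; last by lra.
by rewrite mulrCA mulrA [A * _]mulrC; exact: hA.
Qed.

Lemma K_even_sup m : ~~ odd m -> (2 * m.+2 < d)%N -> 0 < K_ R d m -> 0 < K_ R d m.+1 ->
  0 < K_ R d m.+2 /\ forall A X : R, 0 <= A -> 0 <= X ->
    (forall a b, a < 0 -> b < 0 -> 0 < r_ d m a ->
      r_ d m a * h_ d m.+1 b * X <=
      ((- a + m.+1%:R) / K_ R d m - b * (r_ d m a / K_ R d m.+1)) * A) ->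
    K_ R d m.+2 * X <= A.
Proof.
move=> om md K0 K1; rewrite K_even//.
set S := [set _ | _ in _].
have den (a b : R) : a < 0 -> b < 0 -> 0 < r_ d m a ->
    (K_ R d m)^-1 <= (- a + m.+1%:R) / K_ R d m - b * (r_ d m a / K_ R d m.+1).
  move=> a0 b0 r0; rewrite -[X in X <= _]addr0; apply: lerD.
    rewrite -[X in X <= _]mul1r ler_pM2r ?invr_gt0// -[X in X <= _]add0r.
    by apply: lerD; [rewrite oppr_ge0 ltW|rewrite ler1n].
  by rewrite -mulNr mulr_ge0 ?oppr_ge0 ?(ltW b0)// divr_ge0 ?ltW.
have den0 (a b : R) : a < 0 -> b < 0 -> 0 < r_ d m a ->
    0 < (- a + m.+1%:R) / K_ R d m - b * (r_ d m a / K_ R d m.+1).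
  by move=> a0 b0 r0; apply: lt_le_trans (den a b a0 b0 r0); rewrite invr_gt0.
have q0 : - 4^-1 < 0 :> R by rewrite oppr_lt0 invr_gt0.
have rq := r_quarter md; have hq := h_quarter md.
have Sx : S (r_ d m (- 4^-1) * h_ d m.+1 (- 4^-1) /
    ((- - 4^-1 + m.+1%:R) / K_ R d m - (- 4^-1) * (r_ d m (- 4^-1) / K_ R d m.+1))).
  by exists (- 4^-1, - 4^-1) => //; exact: admissible_quarter.
have x0 := divr_gt0 (mulr_gt0 rq hq) (den0 _ _ q0 q0 rq).
pose Mr : R := (d%:R - 2 * m%:R - 2) ^+ 2 / 16 + m%:R * (d%:R - 2 * m%:R - 3) / 2.
pose Mh : R := (d%:R - 2 * m.+1%:R - 2) ^+ 2 / 16.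
have [] := sup_posP (M := Mr * Mh * K_ R d m) Sx x0.
  move=> y [[a b]] /= [/= a0 b0]; rewrite subn1 subn2/= => r0 h0 <-.
  apply: ler_pM; rewrite ?mulr_ge0 ?invr_ge0 ?(ltW r0) ?(ltW h0)//.
  - by rewrite ltW// den0.
  - apply: ler_pM; rewrite ?(ltW r0) ?(ltW h0) ?h_le//.
    by rewrite /r_ lerD2r h_le.
  - rewrite -[X in _ <= X]invrK lef_pV2 ?posrE ?den0 ?invr_gt0//; exact: den.
move=> S0 hS; split => // A X A0 X0 hA; apply: hS => //.
move=> y [[a b]] /= [/= a0 b0]; rewrite subn1 subn2/= => r0 h0 <-.
by rewrite mulrAC ler_pdivrMr ?den0// [A * _]mulrC; exact: hA.
Qed.

(** The quotient is that of the odd steps, at the point [b = 1 - sqrt (d / 2)] where it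
    is largest; so the first order is an odd step like the others. *)
Lemma K_one : (2 < d)%N -> exists b : R, [/\ b < 0, 0 < h_ d 0 b &
  K_ R d 1 = h_ d 0 b / (1 - b)].
Proof.
move=> d2; pose t : R := Num.sqrt (d%:R / 2).
have d0 : 0 < d%:R :> R by rewrite ltr0n (leq_trans _ d2).
have d2' : 2 < d%:R :> R by rewrite ltr_nat.
have tt : t ^+ 2 = d%:R / 2 by rewrite sqr_sqrtr// divr_ge0// ltW.
have t1 : 1 < t.
  rewrite -[X in X < _](@sqrtr1 R) ltr_sqrt; last by rewrite divr_gt0.
  by rewrite ltr_pdivlMr// mul1r.
have Eh : h_ d 0 (1 - t) = t * (t - 1) ^+ 2.
  have Ed : d%:R = 2 * t ^+ 2 :> R by rewrite tt; field.
  by rewrite /h_ Ed; field.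
exists (1 - t); rewrite Eh; split.
- by lra.
- by rewrite mulr_gt0 ?exprn_gt0//; lra.
- have t0 : t != 0 by rewrite gt_eqF//; lra.
  have -> : 1 - (1 - t) = t by ring.
  rewrite /K_ -tt.
  have -> : Num.sqrt 2 / Num.sqrt d%:R = t^-1 :> R.
    by rewrite /t sqrtrM ?(ltW d0)// sqrtrV// invfM invrK mulrC.
  by field.
Qed.
End constants_theory.

Section recursion.
Context {R : realType} {d : nat}.
Notation rV := 'rV[R]_d.
Implicit Types (x : rV) (u : seq 'I_d -> rV -> R).
Variable eps : R.
Hypothesis eps0 : 0 < eps.
Hypothesis d0 : (0 < d)%N.
Notation regw := (@regw R d eps).

Definition energy l u x : R :=
  if odd l then \sum_i (iter l./2 jet_lap u [:: i] x) ^+ 2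
  else (iter l./2 jet_lap u [::] x) ^+ 2.

Lemma jet_cont u s : jet u -> cube_continuous (u s).
Proof. by move=> ju; exact: per_deriv_cont (ju s (Ordinal d0)). Qed.

Lemma cont_energy l u : jet u -> cube_continuous (energy l u).
Proof.
move=> ju; have jm := jet_iter_lap l./2 ju; rewrite /energy; case: (odd l).
  by apply: cont_sum => i; apply: contX; exact: jet_cont.
by apply: contX; exact: jet_cont.
Qed.

Lemma Int_lap u : jet u -> Int (jet_lap u [::]) = 0.
Proof.
move=> ju; rewrite /jet_lap Int_sum => [|j]; last exact: jet_cont.
by apply: big1 => j _; exact: Int_per_deriv (ju [:: j] j).
Qed.

Lemma Int_iter_lap m u : jet u -> Int (u [::]) = 0 -> Int (iter m jet_lap u [::]) = 0.
Proof. by move=> ju u0; case: m => //= m; exact: Int_lap (jet_iter_lap m ju). Qed.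

Lemma jet_poincare u : jet u -> Int (u [::]) = 0 ->
  Int (fun x => u [::] x ^+ 2) <= Int (fun x => \sum_i u [:: i] x ^+ 2).
Proof.
move=> ju u0; exact: (@Int_poincare R d (u [::]) (fun i => u [:: i]) (@jet_cont u _ ju) (ju [::]) u0).
Qed.

(** [|grad u|^2] is [- u Lap u] up to a divergence, and [- 2 u Lap u] is at most
    [u^2 + (Lap u)^2], where [u^2] is controlled by the Poincare inequality. *)
Lemma jet_poincare_lap u : jet u -> Int (u [::]) = 0 ->
  Int (fun x => \sum_i u [:: i] x ^+ 2) <= Int (fun x => (\sum_j u [:: j; j] x) ^+ 2).
Proof.
move=> ju u0; have P := jet_poincare ju u0.
have D i := per_derivM (ju [::] i) (ju [:: i] i).
have c s := @jet_cont u s ju.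
pose E i x : R := u [:: i] x * u [:: i] x + u [::] x * u [:: i; i] x.
have cE : cube_continuous (fun x => \sum_i E i x).
  by apply: cont_sum => i; exact: per_deriv_contD (D i).
have IE : Int (fun x => \sum_i E i x) = 0.
  rewrite Int_sum => [|i]; last exact: per_deriv_contD (D i).
  by apply: big1 => i _; exact: Int_per_deriv (D i).
have cA : cube_continuous (fun x => \sum_i u [:: i] x ^+ 2) by apply: cont_sum => i; exact: contX.
have cB : cube_continuous (fun x => u [::] x ^+ 2) by exact: contX.
have cL : cube_continuous (fun x => (\sum_j u [:: j; j] x) ^+ 2) by apply: contX; exact: cont_sum.
have : Int (fun x => 2 * (\sum_i u [:: i] x ^+ 2)) <=
    Int (fun x => u [::] x ^+ 2 + (\sum_j u [:: j; j] x) ^+ 2 + 2 * \sum_i E i x).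
  apply: Int_le => [||x _].
  - by apply: contM => //; exact: cont_cst.
  - by apply: contD; [exact: contD|apply: contM => //; exact: cont_cst].
  - rewrite /E big_split /= -mulr_sumr.
    rewrite (eq_bigr (fun i => u [:: i] x ^+ 2)) => [|i _]; last by rewrite expr2.
    set A := \sum_i _; set L := \sum_i _; set w := u [::] x.
    rewrite -subr_ge0 (_ : _ - _ = (w + L) ^+ 2) ?sqr_ge0//; ring.
rewrite IntZ// IntD//; [|exact: contD|by apply: contM => //; exact: cont_cst].
rewrite IntD// IntZ// IE; lra.
Qed.

Definition rellich_holds l := forall u, jet u -> Int (u [::]) = 0 ->
  K_ R d l * Int (fun x => regw x ^+ l * u [::] x ^+ 2) <= Int (energy l u).

Section step.
Variables (m : nat) (u : seq 'I_d -> rV -> R).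
Hypotheses (ju : jet u) (u0 : Int (u [::]) = 0).
Hypotheses (K0 : 0 < K_ R d m.*2) (P : rellich_holds m.*2).

Let v := iter m jet_lap u.
Let jv : jet v. Proof. exact: jet_iter_lap. Qed.
Let v0 : Int (v [::]) = 0. Proof. exact: Int_iter_lap. Qed.

Let energyE (u' : seq 'I_d -> rV -> R) :
  energy m.*2 u' = (fun x => (iter m jet_lap u' [::] x) ^+ 2).
Proof. by apply/funext => x; rewrite /energy odd_double doubleK. Qed.

Lemma energy_odd : energy m.*2.+1 u = (fun x => \sum_i v [:: i] x ^+ 2).
Proof. by apply/funext => x; rewrite /energy /= odd_double /= uphalf_double. Qed.

Lemma energy_even : energy m.*2.+2 u = (fun x => (\sum_j v [:: j; j] x) ^+ 2).
Proof. by apply/funext => x; rewrite /energy /= odd_double /= doubleK. Qed.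

(** The inequality for each partial derivative of [u], summed. *)
Lemma grad_step :
  K_ R d m.*2 * Int (fun x => regw x ^+ m.*2 * \sum_i u [:: i] x ^+ 2) <=
  Int (fun x => \sum_i v [:: i] x ^+ 2).
Proof.
have cu s := @jet_cont u s ju; have cv s := @jet_cont v s jv.
rewrite (@Int_ext _ _ _ (fun x => \sum_i (regw x ^+ m.*2 * u [:: i] x ^+ 2))); last first.
  by move=> x _; rewrite mulr_sumr.
rewrite !Int_sum => [|i|i]; [|by exact: contX|by apply: contM; [exact: cont_regwX|exact: contX]].
rewrite mulr_sumr; apply: ler_sum => i _.
have := P (jet_jet_partial i ju) (Int_per_deriv (ju [::] i)).
rewrite energyE => /le_trans; apply; rewrite le_eqVlt; apply/orP; left; apply/eqP.
by apply: Int_ext => x Cx; rewrite (iter_lap_partial m i ju).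
Qed.

(** Hardy's inequality of weight [k = 2 m] bounds the left-hand side by [int q^k |grad u|^2]
    and [int q^k u^2].  The case [k] bounds the first through the partial derivatives of
    [u], and the second by [int v^2], hence by [int |grad v|^2] since [v] has mean zero. *)
Lemma odd_step (b : R) : b < 0 ->
  K_ R d m.*2 * h_ d m.*2 b * Int (fun x => regw x ^+ m.*2.+1 * u [::] x ^+ 2) <=
  (1 - b) * Int (energy m.*2.+1 u).
Proof.
move=> b0; rewrite energy_odd.
have H := weighted_hardy eps0 d0 m.*2 b0 (fun i => ju [::] i).
have G := grad_step.
have := P ju u0; rewrite energyE -/v => /le_trans/(_ (jet_poincare jv v0)).
move: H G; set X := Int _; set Y := Int _; set Z := Int _; set A := Int _ => H G Q.
have {}H : K_ R d m.*2 * h_ d m.*2 b * X <= K_ R d m.*2 * (Z - b * Y).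
  by rewrite -mulrA ler_pM2l// lerBrDr.
apply: le_trans H _; rewrite mulrBr mulrBl mul1r; apply: lerD => //.
by rewrite lerN2 mulrCA ler_nM2l.
Qed.

(** With [k = 2 m], Hardy's inequality of weight [k + 1] leaves [int q^(k+1) |grad u|^2] and
    [int q^(k+1) u^2].  The second is the case [k + 1].  Rellich's inequality bounds the
    first by [int q^k (Lap u)^2] and [int q^k |grad u|^2], which the case [k] controls when
    applied to [Lap u] and to the partial derivatives of [u]. *)
Lemma even_step (a b : R) : a < 0 -> b < 0 -> 0 < r_ d m.*2 a ->
  0 < K_ R d m.*2.+1 -> rellich_holds m.*2.+1 ->
  r_ d m.*2 a * h_ d m.*2.+1 b * Int (fun x => regw x ^+ m.*2.+2 * u [::] x ^+ 2) <=
  ((- a + m.*2.+1%:R) / K_ R d m.*2 - b * (r_ d m.*2 a / K_ R d m.*2.+1)) *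
    Int (energy m.*2.+2 u).
Proof.
move=> a0 b0 r0 K1 P1.
have H := weighted_hardy eps0 d0 m.*2.+1 b0 (fun i => ju [::] i).
have B := weighted_rellich eps0 d0 m.*2 a0 ju.
have L := jet_poincare_lap jv v0.
have G := le_trans grad_step L.
have Q := P1 u ju u0; rewrite energy_odd in Q; have {}Q := le_trans Q L.
have T := P (jet_jet_lap ju) (Int_lap ju).
rewrite energyE -iterSr /= -/v in T.
rewrite energy_even; move: H B G Q T {L}.
set X := Int (fun x => regw x ^+ m.*2.+2 * _); set Y := Int _; set Z := Int _.
set U := Int (fun x => regw x ^+ m.*2 * _); set U' := Int _.
set A := Int _ => H B G Q T.
have kG : 0 <= m.*2%:R - a by rewrite subr_ge0 (le_trans (ltW a0)).
have T' : U <= A / K_ R d m.*2 by rewrite ler_pdivlMr// mulrC.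
have G' : U' <= A / K_ R d m.*2 by rewrite ler_pdivlMr// mulrC.
have Q' : Y <= A / K_ R d m.*2.+1 by rewrite ler_pdivlMr// mulrC.
have s1 : r_ d m.*2 a * (h_ d m.*2.+1 b * X) <= r_ d m.*2 a * (Z - b * Y).
  by rewrite ler_pM2l// lerBrDr.
have s2 : (m.*2%:R - a) * U' <= (m.*2%:R - a) * (A / K_ R d m.*2) by rewrite ler_wpM2l.
have s3 : (- b * r_ d m.*2 a) * Y <= (- b * r_ d m.*2 a) * (A / K_ R d m.*2.+1).
  by rewrite ler_wpM2l// mulr_ge0 ?oppr_ge0 ?ltW.
have s4 := lerD (lerD (le_trans B (lerD T' s2)) s3) s1.
rewrite -subr_ge0 in s4; rewrite -subr_ge0; apply: le_trans s4 _.
rewrite le_eqVlt; apply/orP; left; apply/eqP.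
by rewrite -natr1; field; rewrite !gt_eqF.
Qed.
End step.

Lemma rellich_weighted l : (2 * l < d)%N -> 0 < K_ R d l /\ rellich_holds l.
Proof.
have X0 n u : 0 <= Int (fun x => regw x ^+ n * u [::] x ^+ 2).
  by apply: Int_ge0 => x _; rewrite mulr_ge0 ?sqr_ge0// exprn_ge0// ltW// regw_gt0.
have A0 n u : 0 <= Int (energy n u).
  apply: Int_ge0 => x _; rewrite /energy; case: ifP => _; last exact: sqr_ge0.
  by apply: sumr_ge0 => i _; exact: sqr_ge0.
elim/ltn_ind: l => l IH ld.
have [lo|le] := boolP (odd l).
  have El : l = (l./2).*2.+1 by rewrite -[LHS]odd_double_half lo.
  have kd : (2 * (l./2).*2 < d)%N by apply: leq_ltn_trans ld; rewrite leq_mul2l {2}El leqnSn.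
  have kl : ((l./2).*2 < l)%N by rewrite {2}El.
  have [K0 P0] := IH _ kl kd.
  move: (l./2) El K0 P0 {IH kl kd lo} => m El K0 P0.
  case: m => [|m] in El K0 P0 *.
    rewrite El in ld *; have [b [b0 h0 Eb]] := K_one (R := R) ld.
    have b1 : 0 < 1 - b by rewrite subr_gt0 (lt_trans b0).
    rewrite /rellich_holds Eb; split; first exact: divr_gt0.
    move=> u ju u0; have := odd_step ju u0 K0 P0 b0.
    by rewrite /= mul1r mulrAC ler_pdivrMr// [_ * (1 - b)]mulrC.
  rewrite El in ld *; rewrite doubleS in ld K0 P0 *.
  have [] := K_odd_sup (R := R) (m := m.*2.+1) _ ld K0; first by rewrite /= odd_double.
  move=> K1 hK; split => // u ju u0; apply: hK => // b b0.
  exact: (@odd_step m.+1 u ju u0 K0 P0 b b0).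
case: l le ld IH => [|[//|l]] le ld IH.
  split; first exact: ltr01.
  move=> u ju u0; rewrite mul1r le_eqVlt; apply/orP; left; apply/eqP.
  by apply: Int_ext => x _; rewrite expr0 mul1r.
rewrite /= negbK in le.
have El : l = (l./2).*2 by rewrite -[LHS]odd_double_half (negbTE le).
have [K0 P0] : 0 < K_ R d l /\ rellich_holds l.
  by apply: IH; [rewrite ltnW|apply: leq_ltn_trans ld; rewrite leq_mul2l ltnW].
have [K1 P1] : 0 < K_ R d l.+1 /\ rellich_holds l.+1.
  by apply: IH => //; apply: leq_ltn_trans ld; rewrite leq_mul2l leqnSn.
have [K2 hK] := K_even_sup le ld K0 K1; split => // u ju u0; apply: hK => // a b a0 b0 r0.
rewrite El in K0 P0 K1 P1 r0 *.
exact: even_step.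
Qed.
End recursion.

(** * Complex-valued functions and the singular weight *)

Section final.
Context {R : realType} {d : nat}.
Notation rV := 'rV[R]_d.
Notation box := ((@rV_of_tuple R d) @^-1` (@cube R d)).
Implicit Types (x : rV) (f : rV -> R[i]) (u v : seq 'I_d -> rV -> R).

Lemma normc_sqr (z : R[i]) : Normc.normc z ^+ 2 = complex.Re z ^+ 2 + complex.Im z ^+ 2.
Proof. by case: z => a b /=; rewrite sqr_sqrtr// addr_ge0// sqr_ge0. Qed.

Definition represents f u v := forall x, cube x -> f x = (u [::] x +i* v [::] x)%C.

Lemma represents_partial f u v i : jet u -> jet v -> represents f u v ->
  represents (partial i f) (jet_partial i u) (jet_partial i v).
Proof.
move=> ju jv fuv x Cx; rewrite /partial /jet_partial /=.
have [_ _ du _] := ju [::] i; have [_ _ dv _] := jv [::] i.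
have [_ <-] := du x Cx; have [_ <-] := dv x Cx.
have e0 : delta_mx 0 i != 0 :> rV.
  by apply/eqP => /rowP/(_ i)/eqP; rewrite !mxE !eqxx oner_eq0.
by congr (_ +i* _)%C; apply: near_eq_derive => //; apply: filterS (nbhs_cube Cx) => y Cy;
  rewrite /= fuv.
Qed.

Lemma represents_laplacian f u v : jet u -> jet v -> represents f u v ->
  represents (laplacian f) (jet_lap u) (jet_lap v).
Proof.
move=> ju jv fuv x Cx; rewrite /laplacian /jet_lap /=.
transitivity (\sum_(i < d) (u [:: i; i] x +i* v [:: i; i] x)%C).
  apply: eq_bigr => i _.
  have F1 := represents_partial i ju jv fuv.
  exact: (represents_partial i (jet_jet_partial i ju) (jet_jet_partial i jv) F1).
by elim: (index_enum _) => [|i r IH]; rewrite ?big_nil// !big_cons IH.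
Qed.

Lemma represents_iter f u v m : jet u -> jet v -> represents f u v ->
  represents (iter m (@laplacian R d) f) (iter m jet_lap u) (iter m jet_lap v).
Proof.
move=> ju jv fuv; elim: m => //= m IH.
by apply: represents_laplacian IH; exact: jet_iter_lap.
Qed.

Lemma norm_half_laplacian_sqr l f u v x : jet u -> jet v -> represents f u v -> cube x ->
  norm_half_laplacian l f x ^+ 2 = energy l u x + energy l v x.
Proof.
move=> ju jv fuv Cx; have fl := represents_iter l./2 ju jv fuv.
rewrite /norm_half_laplacian /energy; case: (odd l); last by rewrite normc_sqr fl.
rewrite /euclidean_norm sqr_sqrtr; last by apply: sumr_ge0 => i _; exact: sqr_ge0.
rewrite -big_split /=; apply: eq_bigr => i _; rewrite normc_sqr mxE.
by rewrite (represents_partial _ (jet_iter_lap _ ju) (jet_iter_lap _ jv) fl).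
Qed.

Lemma Cinfty_per_jets f : Cinfty_per f -> exists u v, [/\ jet u, jet v & represents f u v].
Proof.
move=> [g [gf gc gd] gp].
exists (fun s x => complex.Re (g s x)), (fun s x => complex.Im (g s x)); split.
- move=> s i; split; [exact: (gc s).1|exact: (gc (i :: s)).1| |].
    by move=> x Cx; have [[d1 _] ->] := gd s i x Cx; exact/derivableP.
  by move=> x y *; rewrite (gp s i x y).
- move=> s i; split; [exact: (gc s).2|exact: (gc (i :: s)).2| |].
    by move=> x Cx; have [[_ d1] ->] := gd s i x Cx; exact/derivableP.
  by move=> x y *; rewrite (gp s i x y).
- by move=> x Cx; rewrite -(gf x (cube_closed Cx)) /=; case: (g [::] x).
Qed.

Lemma cube_integral_cont (F G : rV -> R) : cube_continuous G -> (forall x, cube x -> F x = G x) ->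
  cube_integral (fun x => (F x)%:E) = (Int G)%:E.
Proof.
move=> cG FG; rewrite /cube_Rintegral.
rewrite (bRintegral_EFin (@measurable_box R d) (lebesgue_box_fin d) (bmeas_cont cG)).
by apply: eq_integral => t /set_mem Bt; rewrite FG.
Qed.

(** The factor [omega^2] makes the limit 0 at the origin, which is also the value that the
    quotient by [omega^(2 l)] takes there; the convergence thus holds everywhere. *)
Definition weight_approx l (n : nat) x : R := omega2 x * regw (n.+1%:R^-1) x ^+ l.+1.

Lemma weight_approx_cvg l x : (0 < l)%N ->
  weight_approx l ^~ x @ \oo --> (omega x ^+ (2 * l))^-1.
Proof.
move=> l0; rewrite exprM omega_sqr /weight_approx.
have [->|W0] := eqVneq (omega2 x) 0.
  rewrite expr0n gtn_eqF// invr0 (_ : (fun n : nat => _) = (fun=> 0)); first exact: cvg_cst.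
  by apply/funext => n; rewrite mul0r.
have -> : (omega2 x ^+ l)^-1 = omega2 x * (omega2 x)^-1 ^+ l.+1 by rewrite exprVn exprS invfM mulVKf.
apply: cvgM; first exact: cvg_cst.
have cq : regw n.+1%:R^-1 x @[n --> \oo] --> (omega2 x)^-1.
  rewrite /regw; apply: cvgV => //; rewrite -[X in _ --> X]addr0.
  by apply: cvgD; [exact: cvg_cst|exact: cvg_harmonic].
exact: (cvg_comp _ _ cq (@exprn_continuous R l.+1 (omega2 x)^-1)).
Qed.

Lemma regw_anti (e1 e2 : R) x : 0 < e1 -> e1 <= e2 -> regw e2 x <= regw e1 x.
Proof.
move=> e10 e12; have e20 := lt_le_trans e10 e12.
by rewrite lef_pV2 ?posrE ?omega2D_gt0// lerD2l.
Qed.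

Lemma weight_approx_ge0 l n x : 0 <= weight_approx l n x.
Proof. by rewrite mulr_ge0 ?omega2_ge0// exprn_ge0// ltW// regw_gt0// invr_gt0 ltr0n. Qed.

Lemma weight_approx_le l n x : weight_approx l n x <= regw (n.+1%:R^-1) x ^+ l.
Proof.
have e0 : 0 < n.+1%:R^-1 :> R by rewrite invr_gt0 ltr0n.
have q0 := regw_gt0 e0 x.
rewrite /weight_approx exprS mulrA [omega2 x * _]mulrC regw_omega2// ger_pMl ?exprn_gt0//.
by rewrite gerBl mulr_ge0// ltW.
Qed.

Lemma weight_approx_nd l x : {homo weight_approx l ^~ x : m n / (m <= n)%N >-> m <= n}.
Proof.
move=> m n mn; have e0 k : 0 < k.+1%:R^-1 :> R by rewrite invr_gt0 ltr0n.
apply: ler_wpM2l; first exact: omega2_ge0.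
apply: lerXn2r; rewrite ?nnegrE ?(ltW (regw_gt0 (e0 _) _))//.
by apply: regw_anti => //; rewrite lef_pV2 ?posrE ?ltr0n// ler_nat.
Qed.

Lemma cont_weight_approx l n : (0 < d)%N -> cube_continuous (weight_approx l n).
Proof.
move=> d0; apply: contM; first exact: per_deriv_cont (per_deriv_omega2 (Ordinal d0)).
by apply: cont_regwX => //; rewrite invr_gt0 ltr0n.
Qed.

(** Monotone convergence: the regularised weights increase to the singular one, and
    are dominated by the powers of [regw]. *)
Lemma cube_integral_weight_le l (F : rV -> R) (G : rV -> R) (M : R) :
  (0 < d)%N -> (0 < l)%N -> cube_continuous G ->
  (forall x, cube x -> F x = G x) -> (forall x, cube x -> 0 <= G x) ->
  (forall e : R, 0 < e -> Int (fun x => regw e x ^+ l * G x) <= M) ->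
  (cube_integral (fun x => (F x / omega x ^+ (2 * l))%:E) <= M%:E)%E.
Proof.
move=> d0 l0 cG FG G0 hM; rewrite /cube_integral.
pose g n (t : d.-tuple R) := (G (rV_of_tuple t) * weight_approx l n (rV_of_tuple t))%:E.
have cg n : cube_continuous (fun x => G x * weight_approx l n x).
  by apply: contM => //; exact: cont_weight_approx.
have mg n : measurable_fun box (g n).
  by apply/measurable_EFinP; have [] := bmeas_cont (cg n).
have gc t : box t -> g ^~ t @ \oo --> (F (rV_of_tuple t) / omega (rV_of_tuple t) ^+ (2 * l))%:E.
  move=> Bt; apply: cvg_EFin; first by near=> n.
  rewrite (FG _ Bt); apply: cvgM; first exact: cvg_cst.
  exact: weight_approx_cvg.
have -> : (\int[lebesgue_tuple R d]_(t in box) (F (rV_of_tuple t) / omega (rV_of_tuple t) ^+ (2 * l))%:E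
  = \int[lebesgue_tuple R d]_(t in box) limn (g ^~ t))%E.
  by apply: eq_integral => t /set_mem Bt; apply/esym/cvg_lim => //; exact: gc.
have mono : (\int[lebesgue_tuple R d]_(t in box) g n t)%E @[n --> \oo] -->
    (\int[lebesgue_tuple R d]_(t in box) limn (g ^~ t))%E.
  apply: cvg_monotone_convergence => //; first exact: measurable_box.
    by move=> n t Bt; rewrite lee_fin mulr_ge0 ?weight_approx_ge0 ?G0.
  move=> t Bt m n mn; rewrite lee_fin ler_wpM2l ?G0//.
  exact: weight_approx_nd.
rewrite -(cvg_lim _ mono)//; apply: lime_le.
  by apply/cvg_ex; eexists; exact: mono.
near=> n; have e0 : 0 < n.+1%:R^-1 :> R by rewrite invr_gt0 ltr0n.
rewrite -(bRintegral_EFin (@measurable_box R d) (lebesgue_box_fin d) (bmeas_cont (cg n))) lee_fin.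
rewrite -[X in X <= _]/(Int (fun x => G x * weight_approx l n x)).
apply: le_trans (hM _ e0); apply: Int_le => //.
  by apply: contM => //; exact: cont_regwX.
by move=> x Cx; rewrite mulrC ler_wpM2r ?G0 ?weight_approx_le.
Unshelve. all: by end_near. Qed.
End final.

Theorem theorem15 (R : realType) (d l : nat) (psi : 'rV[R]_d -> R[i])
    (l_gt0 : (0 < l)%N) (d_gt2l : (2 * l < d)%N)
    (psi_per : Cinfty_per psi) (psi_avg0 : cube_Cintegral psi = 0) :
  (cube_integral (fun x => (norm_half_laplacian l psi x ^+ 2)%:E) >=
   (K_ R d l)%:E *
   cube_integral (fun x => (Normc.normc (psi x) ^+ 2 / omega x ^+ (2 * l))%:E))%E.
Proof.
have d0 : (0 < d)%N by exact: leq_ltn_trans d_gt2l.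
have [u [v [ju jv puv]]] := Cinfty_per_jets psi_per.
have cu s := @jet_cont R d d0 u s ju; have cv s := @jet_cont R d d0 v s jv.
move: psi_avg0; rewrite /cube_Cintegral => -[psiR psiI].
have u0 : Int (u [::]) = 0 by rewrite -psiR; apply: Int_ext => x Cx; rewrite /= puv.
have v0 : Int (v [::]) = 0 by rewrite -psiI; apply: Int_ext => x Cx; rewrite /= puv.
have ceu := cont_energy (l := l) d0 ju; have cev := cont_energy (l := l) d0 jv.
rewrite (@cube_integral_cont R d (fun x => norm_half_laplacian l psi x ^+ 2) _ (contD ceu cev)); last first.
  by move=> x Cx; exact: (norm_half_laplacian_sqr l ju jv puv Cx).
have [K0 _] := rellich_weighted (R := R) (ltr01) d0 d_gt2l.
set A := Int _.
have -> : A%:E = ((K_ R d l)%:E * (A / K_ R d l)%:E)%E.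
  by rewrite -EFinM mulrC divfK// gt_eqF.
apply: lee_wpmul2l; first by rewrite lee_fin ltW.
apply: (@cube_integral_weight_le _ _ _ _ (fun x => u [::] x ^+ 2 + v [::] x ^+ 2)) => //.
- by apply: contD; exact: contX.
- by move=> x Cx; rewrite normc_sqr puv.
- by move=> x _; rewrite addr_ge0 ?sqr_ge0.
- move=> e e0; have [_ P] := rellich_weighted e0 d0 d_gt2l.
  rewrite ler_pdivlMr// mulrC /A IntD//.
  rewrite (@Int_ext _ _ _ (fun x => regw e x ^+ l * u [::] x ^+ 2 + regw e x ^+ l * v [::] x ^+ 2)).
    rewrite IntD; [|by apply: contM; [exact: cont_regwX|exact: contX]..].
    by rewrite mulrDr lerD// P.
  by move=> x _; rewrite mulrDr.
Qed.
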